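(* Let $G$ be a compactly generated locally compact group. Then the map $\mathrm I:\mathrm{ULat}(G)\to\mathrm{IRS}(G)$, $\mathrm I(\Gamma)=\mu_\Gamma$, is continuous.
   Context: A uniform lattice in $G$ is a discrete subgroup $\Gamma\le G$ such that $G=\Gamma K$ for some compact $K\subset G$. $\mathrm{Sub}(G)$ is the (compact) space of closed subgroups of $G$ with the Chabauty topology, generated by the sub-basis consisting of the sets $\{H\le G \text{ closed}: H\cap U\neq\emptyset\}$ for $U\subset G$ open and $\{H\le G\text{ closed}: H\cap K=\emptyset\}$ for $K\subset G$ compact. $G$ acts continuously on $\mathrm{Sub}(G)$ by conjugation. An invariant random subgroup of $G$ is a $G$-invariant Borel probability measure on $\mathrm{Sub}(G)$, and $\mathrm{IRS}(G)$ is the space of all invariant random subgroups with the weak-$*$ topology. $\mathrm{ULat}(G)$ is the space of all uniform lattices in $G$ with the topology induced from $\mathrm{Sub}(G)$. For $\Gamma\in\mathrm{ULat}(G)$, $\mu_\Gamma\in\mathrm{IRS}(G)$ is the push-forward of the $G$-invariant probability measure on $G/\Gamma$ under the map $G/\Gamma\to\mathrm{Sub}(G)$, $g\Gamma\mapsto g\Gamma g^{-1}$. *)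

(* Defs.v *)
From HB Require Import structures.
From mathcomp Require Import all_boot all_order all_algebra.
From mathcomp Require Import all_classical all_reals all_analysis.

Set Implicit Arguments.
Unset Strict Implicit.
Unset Printing Implicit Defensive.

Import Order.TTheory GRing.Theory Num.Theory.
Import numFieldNormedType.Exports.

Local Open Scope classical_set_scope.
Local Open Scope quotient_scope.

HB.mixin Record isTopologicalGroup G & Topological G & Group G := {
  mulg_continuous : continuous (fun xy : G * G => (xy.1 * xy.2)%g) ;
  invg_continuous : continuous (fun x : G => (x^-1)%g)
}.

#[short(type="topologicalGroupType")]
HB.structure Definition TopologicalGroup :=
  { G of Topological G & Group G & isTopologicalGroup G }.

Definition is_subgroup (G : groupType) (H : set G) :=
  [/\ H 1%g, (forall x y, H x -> H y -> H (x * y)%g)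
    & forall x, H x -> H (x^-1)%g].

Definition compactly_generated (G : topologicalGroupType) :=
  exists2 S : set G, compact S & smallest (@is_subgroup G) S = setT.

Definition borel (T : ptopologicalType) : Type := g_sigma_algebraType (@open T).

HB.instance Definition _ (T : ptopologicalType) := Measurable.on (borel T).

Section SubG.
Variable G : topologicalGroupType.

Record SubG := MkSubG {
  sub_set :> set G ;
  sub_closed : closed sub_set ;
  sub_group : is_subgroup sub_set }.

HB.instance Definition _ := gen_eqMixin SubG.
HB.instance Definition _ := gen_choiceMixin SubG.

Lemma is_subgroupT : is_subgroup [set: G].
Proof. by []. Qed.

(* The base point is irrelevant: it only serves the measurableType interface,
   which requires a pointed carrier. *)
HB.instance Definition _ := isPointed.Build SubG (MkSubG closedT is_subgroupT).

Definition chabauty_subbase : set (set SubG) :=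
  [set [set H : SubG | sub_set H `&` U !=set0] | U in [set U : set G | open U]]
  `|`
  [set [set H : SubG | sub_set H `&` K = set0] | K in [set K : set G | compact K]].

HB.instance Definition _ := isSubBaseTopological.Build SubG chabauty_subbase id.

Lemma SubG_eq (H K : SubG) : sub_set H = sub_set K -> H = K.
Proof.
case: H K => [H cH gH] [K cK gK] /= HK; subst K.
by congr MkSubG; exact: Prop_irrelevance.
Qed.

Definition conj_set (g : G) (H : set G) : set G :=
  [set (g * h * g^-1)%g | h in H].

Lemma conj_setE g H : conj_set g H = [set x | H (g^-1 * x * g)%g].
Proof.
apply/seteqP; split => x /=.
  by case=> h Hh <-; rewrite !mulgA mulVg mul1g -mulgA mulVg mulg1.
move=> Hx; exists (g^-1 * x * g)%g => //.
by rewrite !mulgA mulgV mul1g -mulgA mulgV mulg1.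
Qed.

Lemma conj_set_closed g H : closed H -> closed (conj_set g H).
Proof.
move=> cH; rewrite conj_setE.
have c : continuous (fun x : G => (g^-1 * x * g)%g).
  move=> x.
  have c1 : (g^-1 * y)%g @[y --> x] --> (g^-1 * x)%g.
    apply: (@continuous_comp _ _ _ (fun y : G => (g^-1%g, y))
      (fun xy : G * G => (xy.1 * xy.2)%g)).
      by apply: cvg_pair => //=; exact: cvg_cst.
    exact: mulg_continuous.
  apply: (@continuous_comp _ _ _ (fun y : G => (g^-1 * y, g)%g)
    (fun xy : G * G => (xy.1 * xy.2)%g)).
    by apply: cvg_pair => //=; exact: cvg_cst.
  exact: mulg_continuous.
exact: (preimage_closed (fun x _ => c x)).
Qed.

Lemma conj_set_subgroup g H : is_subgroup H -> is_subgroup (conj_set g H).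
Proof.
move=> [H1 HM HV]; rewrite conj_setE; split => /=.
- by rewrite mulg1 mulVg.
- move=> x y Hx Hy; have := HM _ _ Hx Hy.
  by rewrite !mulgA -[(_ * g * _)%g]mulgA mulgV mulg1.
- by move=> x /HV; rewrite !invgM invgK mulgA.
Qed.

Definition conj_sub (g : G) (H : SubG) : SubG :=
  MkSubG (@conj_set_closed g H (@sub_closed H))
    (@conj_set_subgroup g H (sub_group H)).

(* The subspace topology on H is discrete: every point of H is isolated. *)
Definition discrete_subgroup (H : SubG) := sub_set H `<=` isolated H.

Definition uniform_lattice (H : SubG) :=
  discrete_subgroup H /\
  exists2 K : set G, compact K &
    [set (x * k)%g | x in sub_set H & k in K] = setT.

End SubG.

Definition ULat (G : topologicalGroupType) : Type :=
  set_type [set H : SubG G | uniform_lattice H].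

HB.instance Definition _ (G : topologicalGroupType) := Topological.on (ULat G).

Section cosets.
Variables (G : topologicalGroupType) (H : SubG G).

(* x H = y H, so the quotient by this relation is the space G / H of left
   cosets. *)
Definition coset_rel (x y : G) : bool := `[< sub_set H (x^-1 * y)%g >].

Lemma coset_rel_equiv : equiv_class_of coset_rel.
Proof.
have [H1 HM HV] := sub_group H; split.
- by move=> x; apply/asboolP; rewrite mulVg.
- by move=> x y; apply/asboolP/asboolP => /HV; rewrite invgM invgK.
- move=> y x z /asboolP xy /asboolP yz; apply/asboolP.
  by have := HM _ _ xy yz; rewrite mulgA -[(_ * y * _)%g]mulgA mulgV mulg1.
Qed.

Canonical coset_equiv := EquivRelPack coset_rel_equiv.

Definition coset_space : Type := quotient_topology {eq_quot coset_equiv}.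

HB.instance Definition _ := Topological.on coset_space.
HB.instance Definition _ := Quotient.on coset_space.
HB.instance Definition _ :=
  isPointed.Build coset_space (\pi_coset_space 1%g).

(* The next two maps are g . x H = g x H and x H |-> x H x^-1. They are defined on
   a chosen representative; coset_actE and coset_conjE show that the choice does
   not matter. *)
Definition coset_act (g : G) (q : coset_space) : coset_space :=
  \pi_coset_space (g * repr q)%g.

Definition coset_conj (q : coset_space) : SubG G := conj_sub (repr q) H.

Lemma repr_coset (x : G) :
  exists2 h, sub_set H h & repr (\pi_coset_space x) = (x * h)%g.
Proof.
exists (x^-1 * repr (\pi_coset_space x))%g; last by rewrite mulgA mulgV mul1g.
have /esym/eqmodP := reprK (\pi_coset_space x).
by move=> /asboolP.
Qed.

Lemma coset_actE (g x : G) :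
  coset_act g (\pi_coset_space x) = \pi_coset_space (g * x)%g.
Proof.
rewrite /coset_act; have [h Hh ->] := repr_coset x.
apply/esym/eqmodP/asboolP.
by rewrite invgM -!mulgA (mulgA (g^-1)%g) mulVg mul1g mulgA mulVg mul1g.
Qed.

Lemma coset_conjE (x : G) : coset_conj (\pi_coset_space x) = conj_sub x H.
Proof.
apply: SubG_eq; rewrite /coset_conj /=; have [h Hh ->] := repr_coset x.
have [H1 HM HV] := sub_group H.
rewrite !conj_setE; apply/seteqP; split => y /= Hy.
  have := HM _ _ (HM _ _ Hh Hy) (HV _ Hh).
  by rewrite invgM !mulgA mulgV mul1g -[(_ * h * _)%g]mulgA mulgV mulg1.
have := HM _ _ (HM _ _ (HV _ Hh) Hy) Hh.
by rewrite invgM !mulgA.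
Qed.

End cosets.

Section IRS.
Variables (R : realType) (G : topologicalGroupType).

Record IRS := MkIRS {
  irs_prob :> probability (borel (SubG G)) R ;
  irs_invariant : forall (g : G) (A : set (borel (SubG G))), measurable A ->
    pushforward irs_prob (conj_sub g : borel (SubG G) -> borel (SubG G)) A
    = irs_prob A }.

HB.instance Definition _ := gen_eqMixin IRS.
HB.instance Definition _ := gen_choiceMixin IRS.

(* The weak-* topology is the initial topology for mu |-> (f |-> \int f dmu), with
   f ranging over the continuous real functions on SubG G and the target carrying
   the topology of pointwise convergence. *)
Definition irs_integral (mu : IRS) : {ptws continuousType (SubG G) R -> R} :=
  fun f => (\int[irs_prob mu]_H f H)%R.

HB.instance Definition _ := Topological.copy IRS (initial_topology irs_integral).

(* mu = mu_Gam, the push-forward of the G-invariant Borel probability measure m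
   on G / Gam under g Gam |-> g Gam g^-1. *)
Definition is_lattice_irs (Gam : ULat G) (mu : IRS) :=
  exists2 m : probability (borel (coset_space (val Gam))) R,
    (forall (g : G) (A : set (borel (coset_space (val Gam)))), measurable A ->
       pushforward m (coset_act g : borel _ -> borel (coset_space (val Gam))) A
       = m A) &
    forall A : set (borel (SubG G)), measurable A ->
      irs_prob mu A
      = pushforward m
          (@coset_conj G (val Gam) :
             borel (coset_space (val Gam)) -> borel (SubG G)) A.

End IRS.

(* Main.v *)
Require Import Defs.
From mathcomp Require Import all_boot all_order all_algebra.
From mathcomp Require Import all_classical all_reals all_analysis.
From mathcomp Require Import lra ring.
Import Order.TTheory GRing.Theory Num.Theory.
Import numFieldNormedType.Exports.
Set Implicit Arguments.
Unset Strict Implicit.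
Unset Printing Implicit Defensive.
Local Open Scope classical_set_scope.
Local Open Scope ring_scope.
Local Open Scope quotient_scope.

(** For a uniform lattice H, write X = G / H, let m be its invariant
    probability, and for a compactly supported continuous f : G -> R let
    N_H f (g) be the finite sum of f (g x) over x in H ([coset_sum]).
    Unfolding the integral over X defines a positive functional on such f,

        Lambda_H f = integral over X of N_H f dm     ([lattice_haar]),

    and it is left invariant because m is.  If N_H f > 0 everywhere, then the
    weight theta = f / N_H f satisfies N_H theta = 1, so that for every
    continuous w on the space of subgroups

        integral of w dmu_H = Lambda_H (x |-> w (x H x^-1) theta x).

    The point of passing from X, which varies with H, to G, which does not, is
    that left-invariant positive functionals are unique up to a scalar
    ([haar_unique]).  Fix H0 and put Lambda = Lambda_(H0).  Uniqueness says
    that Lambda_H (theta w) Lambda (theta) = Lambda_H (theta) Lambda (theta w)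
    where theta w abbreviates the weighted function above, hence

        (integral of w dmu_H) Lambda (theta) = Lambda (theta w),

    an identity in which H enters only through theta and w (x H x^-1), for one
    fixed functional Lambda.  It remains to let H tend to H0 on the right, and
    three facts make that possible.

    The first is that conjugation is jointly continuous for the Chabauty
    topology ([conj_sub_continuous]).

    The second is the behaviour of N_H f as H tends to H0.  It need not tend
    to N_(H0) f: in a group with small subgroups, H may contain a nontrivial
    finite subgroup close to 1, which makes H a union of clusters of equal
    size around the points of H0.  But the number k(H) of elements of H in a
    fixed compact neighbourhood of 1 measures that size, and N_H f / k(H) does
    tend to N_(H0) f ([lattice_sum_cvg], [coset_sum_cvg]).  Since the identity
    above is homogeneous in theta, theta may be replaced by k(H) theta.

    The third is that the positivity of N_(H0) f passes to nearby H, and this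
    is where compact generation enters ([near_coset_sum_gt0]).  If f is
    supported in K and S generates G, it suffices that N_H f > 0 on the
    compact set formed by 1 and the products of S and of its inverses with K:
    the set where N_H f > 0 is then stable under left translation by S and its
    inverses, hence is all of G.

    Uniqueness is proved by the classical double-integral argument, for which
    a Fubini theorem for positive functionals is enough: the two iterated
    functionals agree on products f(x) g(y), and such products determine a
    positive functional on the compactly supported functions of two variables
    ([posfun_tensor_eq]). *)

(** * Compactly supported functions and positive functionals *)

Section Cc.
Context {R : realType} {X : topologicalType}.
Implicit Types (f g : X -> R) (K : set X).

Definition supported K f := forall x, f x != 0 -> K x.

Definition Cc f := continuous f /\ exists2 K, compact K & supported K f.

Lemma supportedN K f x : supported K f -> ~ K x -> f x = 0.
Proof. by move=> sf; apply: contra_notP => /eqP; exact: sf. Qed.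

Lemma Cc0 : Cc (fun=> 0).
Proof.
split; first by move=> x; exact: cvg_cst.
by exists set0; [exact: compact0 | move=> x; rewrite eqxx].
Qed.

Lemma CcD f g : Cc f -> Cc g -> Cc (fun x => f x + g x).
Proof.
move=> [cf [K cK Kf]] [cg [K' cK' Kg]]; split.
  by move=> x; apply: cvgD; [exact: cf|exact: cg].
exists (K `|` K'); first exact: compactU.
move=> x fg0; have [f0|/Kf] := eqVneq (f x) 0; last by left.
by right; apply: Kg; move: fg0; rewrite f0 add0r.
Qed.

Lemma CcMl f g : continuous g -> Cc f -> Cc (fun x => g x * f x).
Proof.
move=> cg [cf [K cK Kf]]; split.
  by move=> x; apply: cvgM; [exact: cg|exact: cf].
by exists K => // x; rewrite mulf_eq0 negb_or => /andP[_ /Kf].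
Qed.

Lemma CcZ a f : Cc f -> Cc (fun x => a * f x).
Proof. by apply: CcMl => x; exact: cvg_cst. Qed.

Lemma CcN f : Cc f -> Cc (fun x => - f x).
Proof.
move=> /(CcZ (-1)); congr Cc; apply/funext => x; exact: mulN1r.
Qed.

(** A functional is a total map on all functions, of which only the values on
    [Cc] matter: this encodes a positive linear form on the space of compactly
    supported continuous functions. *)
Record posfun (L : (X -> R) -> R) : Prop := PosFun {
  posfunD : forall f g, Cc f -> Cc g -> L (fun x => f x + g x) = L f + L g ;
  posfunZ : forall a f, Cc f -> L (fun x => a * f x) = a * L f ;
  posfun_ge0 : forall f, Cc f -> (forall x, 0 <= f x) -> 0 <= L f }.

Section posfun_theory.
Variables (L : (X -> R) -> R) (pL : posfun L).

Lemma posfunN f : Cc f -> L (fun x => - f x) = - L f.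
Proof.
move=> /(posfunZ pL (-1)); rewrite mulN1r => <-; congr L.
by apply/funext => x; rewrite mulN1r.
Qed.

Lemma posfunB f g : Cc f -> Cc g -> L (fun x => f x - g x) = L f - L g.
Proof. by move=> cf cg; rewrite (posfunD pL cf (CcN cg)) posfunN. Qed.

Lemma posfun0 : L (fun=> 0) = 0.
Proof.
rewrite -[RHS](mul0r (L (fun=> 0))) -(posfunZ pL _ Cc0).
by congr L; apply/funext => x; rewrite mul0r.
Qed.

Lemma le_posfun f g : Cc f -> Cc g -> (forall x, f x <= g x) -> L f <= L g.
Proof.
move=> cf cg fg; rewrite -subr_ge0 -posfunB //; apply: (posfun_ge0 pL).
  exact/CcD/CcN.
by move=> x; rewrite subr_ge0.
Qed.

Lemma norm_posfun_le f g : Cc f -> Cc g -> (forall x, `|f x| <= g x) ->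
  `|L f| <= L g.
Proof.
move=> cf cg fg; rewrite ler_norml -posfunN //; apply/andP; split;
  apply: le_posfun => //; try exact: CcN;
  by move=> x; have := fg x; rewrite ler_norml => /andP[].
Qed.

End posfun_theory.

(** The common core of all compactness arguments below that assemble finitely
    many local functions: a class of nonnegative continuous functions that is
    closed under sums and large near each point of a compact set has a member
    that is large on the whole set.  Taking an abstract class lets the member
    inherit whatever additive property is of interest, such as having integral
    zero in [haar_faithful], or a Fubini estimate in [posfun_tensor_eq]. *)
Lemma compact_patch K (C : set (X -> R)) : compact K ->
  C (fun=> 0) -> (forall f g, C f -> C g -> C (fun x => f x + g x)) ->
  (forall f, C f -> continuous f /\ forall x, 0 <= f x) ->
  (forall x, K x -> exists2 f, C f & 1 < f x) ->
  exists2 f, C f & forall x, K x -> 1 <= f x.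
Proof.
move=> /compact_near_coveringP cK C0 CD Cge Cloc.
(* the functions of the class form a directed set for the pointwise order *)
pose F : set_system (X -> R) := [set P | exists2 f0, C f0 &
  forall f, C f -> (forall x, f0 x <= f x) -> P f].
have FF : Filter F.
  split.
  - by exists (fun=> 0).
  - move=> P Q [f Cf Pf] [g Cg Qg]; exists (fun x => f x + g x); first exact: CD.
    move=> h Ch fgh; split.
      apply: Pf => // x; apply: le_trans (fgh x).
      by rewrite lerDl; exact: (Cge _ Cg).2.
    apply: Qg => // x; apply: le_trans (fgh x).
    by rewrite lerDr; exact: (Cge _ Cf).2.
  - by move=> P Q PQ [f Cf Pf]; exists f => // g Cg fg; apply: PQ; exact: Pf.
have [x Kx|f Cf Kf] := cK _ F (fun f x => C f -> 1 <= f x) FF; last first.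
  by exists f => // x Kx; exact: Kf.
have [f Cf f1] := Cloc x Kx.
exists ([set y | 1 < f y], [set g | C g -> forall y, f y <= g y]) => /=.
  split; last by exists f => // g _ fg _.
  exact: (cvgr_gt (f x) ((Cge _ Cf).1 x)).
by move=> [y g] [/= fy fg] Cg; apply: le_trans (ltW fy) (fg Cg y).
Qed.

Section locally_compact.
Hypotheses (hausX : hausdorff_space X) (lcX : locally_compact [set: X]).

(** Complete regularity separates x from the complement of a compact
    neighbourhood inside U. *)
Lemma bump x (U : set X) : nbhs x U ->
  exists f, [/\ Cc f, (forall y, 0 <= f y), f x = 1 & supported U f].
Proof.
move=> xU; have [K xK' [cK clK]] := lcX (x := x) I.
have xK : nbhs x K.
  by move: xK'; rewrite /within /= => xK; near=> y; apply: (near xK y).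
have clB : closed (~` (U `&` K)°) by apply: open_closedC; exact: open_interior.
have xB : ~ (~` (U `&` K)°) x by apply; exact: filterI.
have /(uniform_separatorP (R := R))[f [cf f01 fx fB]] :=
  @locally_compact_completely_regular X R lcX hausX x _ clB xB.
have fU : supported (U `&` K) (fun y => 1 - f y).
  move=> y; apply: contra_neqP => yUK.
  have -> : f y = 1.
    by apply: fB; exists y => //; move=> /interior_subset.
  exact: subrr.
exists (fun y => 1 - f y); split.
- split; first by move=> y; apply: cvgB; [exact: cvg_cst|exact: cf].
  by exists K => // y /fU[].
- move=> y; rewrite subr_ge0.
  by have /= := f01 _ (imageT f y); rewrite in_itv => /andP[].
- by rewrite (fx (f x)) ?subr0 //; exists x.
- by move=> y /fU[].
Unshelve. all: by end_near. Qed.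

Lemma cutoff K : compact K ->
  exists f, [/\ Cc f, (forall x, 0 <= f x) & forall x, K x -> 1 <= f x].
Proof.
move=> cK.
have [||||f [cf f0] Kf] :=
    @compact_patch K [set f | Cc f /\ forall x, 0 <= f x] cK.
- by split => //; exact: Cc0.
- by move=> f g [cf f0] [cg g0]; split; [exact: CcD|move=> x; exact: addr_ge0].
- by move=> f [[]].
- move=> x Kx; have [f [cf f0 fx _]] := @bump x setT filterT.
  exists (fun x => 2 * f x); last by rewrite fx; lra.
  by split; [exact: CcZ|move=> y; rewrite mulr_ge0].
by exists f.
Qed.

Variables (L : (X -> R) -> R) (pL : posfun L).

(** A positive functional is bounded on the functions supported in a fixed
    compact set, because all of them are dominated by multiples of one cutoff
    function. *)
Lemma posfun_bounded K : compact K -> exists2 B : R, 0 < B &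
  forall e f, 0 <= e -> Cc f -> supported K f -> (forall x, `|f x| <= e) ->
    `|L f| <= e * B.
Proof.
move=> cK; have [u [cu u0 Ku]] := cutoff cK.
exists (L u + 1) => [|e f e0 cf Kf fe].
  by rewrite ltr_wpDl// ?(posfun_ge0 pL).
apply: (@le_trans _ _ (e * L u)); last by rewrite ler_wpM2l// lerDl.
rewrite -(posfunZ pL _ cu); apply: (norm_posfun_le pL) => // [|x].
  exact: CcZ.
have [->|/Kf/Ku u1] := eqVneq (f x) 0; first by rewrite normr0 mulr_ge0.
exact: le_trans (fe x) (ler_peMr _ _).
Qed.

(** Joint convergence at every point of a compact set is uniform convergence
    on it, which a positive functional respects.  The parameter space is
    arbitrary: it is a factor of a product in the Fubini theorem, and the space
    of lattices in the final argument. *)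
Lemma posfun_cvg {T : topologicalType} (t0 : T) (Psi : T -> X -> R) K :
  compact K ->
  (forall x, Psi p.2 p.1 @[p --> (x, t0)] --> Psi t0 x) ->
  (\forall t \near t0, Cc (Psi t) /\ supported K (Psi t)) ->
  L (Psi t) @[t --> t0] --> L (Psi t0).
Proof.
move=> cK Psic nPsi; have [B B0 LB] := posfun_bounded cK.
have [cP KP] := nbhs_singleton nPsi.
apply/cvgrPdist_le => e e0.
have eB0 : 0 < e / B by rewrite divr_gt0.
have nK : \forall t \near t0, K `<=` (fun x => `|Psi t0 x - Psi t x| <= e / B).
  move/compact_near_coveringP : (cK); apply => x Kx.
  have Px : Psi t0 p.1 @[p --> (x, t0)] --> Psi t0 x.
    by apply: cvg_comp; [exact: cvg_fst|exact: cP.1].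
  have : (Psi t0 p.1 - Psi p.2 p.1) @[p --> (x, t0)] --> (0 : R).
    by rewrite -(subrr (Psi t0 x)); apply: cvgB => //; exact: Psic.
  move=> /cvgrPdist_le /(_ _ eB0).
  by apply: filterS => -[y t]; rewrite sub0r normrN.
near=> t.
have [cPt KPt] : Cc (Psi t) /\ supported K (Psi t) by near: t.
have PK : K `<=` (fun x => `|Psi t0 x - Psi t x| <= e / B) by near: t.
rewrite -(posfunB pL)// -[leRHS](divfK (lt0r_neq0 B0)).
apply: LB => //; first exact: ltW.
- exact/CcD/CcN.
- move=> x; have [|/KP//] := eqVneq (Psi t0 x) 0.
  by move=> ->; rewrite sub0r oppr_eq0 => /KPt.
- move=> x; have [/PK//|nKx] := pselect (K x).
  by rewrite (supportedN KP)// (supportedN KPt)// subrr normr0 ltW.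
Unshelve. all: by end_near. Qed.

End locally_compact.
End Cc.

Lemma Cc_bounded {R : realType} {X : topologicalType} (f : X -> R) : Cc f ->
  exists2 B, 0 <= B & forall x, `|f x| <= B.
Proof.
move=> [cf [K /compact_near_coveringP cK Kf]].
have [x Kx|B [/= _ KB]] := cK _ (pinfty_nbhs R) (fun B x => `|f x| <= B) _.
  exists ([set y | `|f y| < `|f x| + 1], [set B | `|f x| + 1 < B]) => /=.
    split; last by exists (`|f x| + 1); split => //; exact: num_real.
    apply: (cvgr_lt `|f x|); last by rewrite ltrDl.
    by apply: cvg_norm; exact: cf.
  by move=> [y B] [/= fy fB]; rewrite ltW// (lt_trans fy).
exists (Num.max 0 (B + 1)) => [|x]; first by rewrite le_max lexx.
have [->|fx] := eqVneq (f x) 0; first by rewrite normr0 le_max lexx.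
by rewrite le_max (KB (B + 1)) ?orbT// ?ltrDl//; exact: Kf.
Qed.

Section compact_nbhs.
Context {X : topologicalType} (R : realType).
Hypotheses (hausX : hausdorff_space X) (lcX : locally_compact [set: X]).

(** The set where a bump function is at least 1/2. *)
Lemma compact_nbhs (x : X) (U : set X) : nbhs x U ->
  exists2 K, compact K & nbhs x K /\ K `<=` U.
Proof.
move=> xU; have [f [cf f0 fx fU]] := bump (R := R) hausX lcX xU.
have [K cK Kf] := cf.2; have f_gt y : 2^-1 <= f y -> f y != 0.
  by move=> fy; rewrite gt_eqF// (lt_le_trans _ fy)// invr_gt0.
exists [set y | 2^-1 <= f y].
  apply: (subclosed_compact _ cK) => [|y /f_gt/Kf//].
  have := @preimage_closed _ _ f [set r | 2^-1 <= r] (fun y _ => cf.1 y).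
  by apply; exact: closed_ge.
split; last by move=> y /f_gt/fU.
apply: (cvgr_ge (f x)); first exact: cf.1.
by rewrite fx invf_lt1// ltr1n.
Qed.

End compact_nbhs.

(** * Products and the Fubini theorem *)

Section product_space.
Context {R : realType} {X Y : topologicalType}.
Hypotheses (hausY : hausdorff_space Y) (lcY : locally_compact [set: Y]).
Implicit Types F : X * Y -> R.

Lemma supported_prod F : Cc F -> exists K K', [/\ compact K, compact K' &
  forall x y, F (x, y) != 0 -> K x /\ K' y].
Proof.
move=> [_ [Q cQ QF]]; exists (fst @` Q), (snd @` Q); split.
- apply: continuous_compact => //; apply: continuous_subspaceT => -[x y].
  exact: cvg_fst.
- apply: continuous_compact => //; apply: continuous_subspaceT => -[x y].
  exact: cvg_snd.
- by move=> x y /QF Qxy; split; exists (x, y).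
Qed.

Lemma Cc_tensor f g : Cc f -> Cc g -> Cc (fun p : X * Y => f p.1 * g p.2 : R).
Proof.
move=> [cf [K cK Kf]] [cg [K' cK' Kg]]; split.
  move=> [x y]; apply: cvgM; apply: cvg_comp; try exact: cf; try exact: cg.
    exact: cvg_fst.
  exact: cvg_snd.
exists (K `*` K'); first exact: compact_setX.
by move=> [x y] /=; rewrite mulf_eq0 negb_or => /andP[/Kf ? /Kg].
Qed.

Lemma Cc_section F x : Cc F -> Cc (fun y => F (x, y)).
Proof.
move=> cF; have [K [K' [cK cK' FK]]] := supported_prod cF.
split; last by exists K' => // y /FK[].
move=> y; apply: cvg_comp; last exact: cF.1.
by apply: cvg_pair => //; exact: cvg_cst.
Qed.

Lemma Cc_sectionl F y : Cc F -> Cc (fun x => F (x, y)).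
Proof.
move=> cF; have [K [K' [cK cK' FK]]] := supported_prod cF.
split; last by exists K => // x /FK[].
move=> x; apply: cvg_comp; last exact: cF.1.
by apply: cvg_pair => //; exact: cvg_cst.
Qed.

Lemma Cc_marginal (M : (Y -> R) -> R) F : posfun M -> Cc F ->
  Cc (fun x => M (fun y => F (x, y))).
Proof.
move=> pM cF; have [K [K' [cK cK' FK]]] := supported_prod cF; split.
  move=> x; apply: (posfun_cvg hausY lcY pM (Psi := fun x y => F (x, y)) cK').
    move=> y; apply: cvg_comp; last exact: cF.1.
    by apply: cvg_pair; [exact: cvg_snd|exact: cvg_fst].
  by near=> z; split; [exact: Cc_section|move=> y /FK[]].
exists K => // x; apply: contra_neqP => nKx.
rewrite -[RHS](posfun0 pM); congr M; apply/funext => y.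
by apply: contra_notP nKx => /eqP /FK[].
Unshelve. all: by end_near. Qed.

End product_space.

Section tensor.
Context {R : realType} {X Y : topologicalType}.
Hypotheses (hausX : hausdorff_space X) (lcX : locally_compact [set: X]).
Hypotheses (hausY : hausdorff_space Y) (lcY : locally_compact [set: Y]).
Implicit Types F : X * Y -> R.

(** Where y is close to a fixed y0, F(x, y) is uniformly close to F(x, y0), so
    that F(x, y) h(y) is close to a product when h is supported near y0.  The
    resulting bound on the difference of P and Q is additive in h, so it holds
    for some h that is at least 1 on the second projection of the support. *)
Lemma posfun_tensor_eq (P Q : (X * Y -> R) -> R) : posfun P -> posfun Q ->
  (forall f g, Cc f -> Cc g ->
    P (fun p => f p.1 * g p.2) = Q (fun p => f p.1 * g p.2)) ->
  forall F, Cc F -> P F = Q F.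
Proof.
move=> pP pQ PQ F cF; have [K [K' [cK cK' FK]]] := supported_prod cF.
have [u [cu u0 Ku]] := cutoff (R := R) hausX lcX cK.
have [v [cv v0 Kv]] := cutoff (R := R) hausY lcY cK'.
pose tens f g : X * Y -> R := fun p => f p.1 * g p.2.
pose B := P (tens u v) * 2 + 1.
have B0 : 0 < B.
  rewrite ltr_wpDl// mulr_ge0// (posfun_ge0 pP)//; first exact: Cc_tensor.
  by move=> p; rewrite mulr_ge0.
have F_snd (h : Y -> R) : Cc h -> Cc (fun p => F p * h p.2).
  move=> ch.
  have -> : (fun p => F p * h p.2) = (fun p => h p.2 * F p).
    by apply/funext => p; rewrite mulrC.
  apply: CcMl => // -[x y]; apply: cvg_comp; last exact: ch.1.
  exact: cvg_snd.
suff le_e e : 0 < e -> `|P F - Q F| <= e * B.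
  apply/eqP; rewrite -subr_eq0 -normr_le0; apply/ler_addgt0Pr => e e0.
  by rewrite add0r (le_trans (le_e (e / B) _)) ?divr_gt0// divfK// lt0r_neq0.
move=> e0.
(* the bound is required for all multiples w h, so that h can be normalized
   once it has been found *)
pose C : set (Y -> R) := [set h | [/\ Cc h, (forall y, 0 <= h y) &
  forall w : Y -> R, continuous w -> (forall y, 0 <= w y) ->
    `|P (fun p => F p * (w p.2 * h p.2)) - Q (fun p => F p * (w p.2 * h p.2))|
    <= e * P (tens u (fun y => w y * h y)) * 2]].
have [||||h [ch h0 hw] Kh] := @compact_patch R Y K' C cK'.
- split => //; first exact: Cc0.
  move=> w cw w0.
  have -> : (fun p => F p * (w p.2 * 0)) = (fun=> 0).
    by apply/funext => p; rewrite !mulr0.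
  have -> : tens u (fun y => w y * 0) = (fun=> 0).
    by apply/funext => p; rewrite /tens !mulr0.
  by rewrite !posfun0// subrr normr0 mulr0 mul0r.
- move=> f g [cf f0 fw] [cg g0 gw]; split.
  + exact: CcD.
  + by move=> y; exact: addr_ge0.
  move=> w cw w0.
  have wf := CcMl cw cf; have wg := CcMl cw cg.
  have -> : (fun p => F p * (w p.2 * (f p.2 + g p.2))) =
    (fun p => F p * (w p.2 * f p.2) + F p * (w p.2 * g p.2)).
    by apply/funext => p; rewrite !mulrDr.
  have -> : tens u (fun y => w y * (f y + g y)) =
    (fun p => tens u (fun y => w y * f y) p + tens u (fun y => w y * g y) p).
    by apply/funext => p; rewrite /tens !mulrDr.
  rewrite (posfunD pP (F_snd _ wf) (F_snd _ wg)).
  rewrite (posfunD pQ (F_snd _ wf) (F_snd _ wg)).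
  rewrite (posfunD pP (Cc_tensor cu wf) (Cc_tensor cu wg)).
  rewrite opprD addrACA (le_trans (ler_normD _ _))// [e * _]mulrDr mulrDl.
  by apply: lerD; [exact: fw|exact: gw].
- by move=> f [[]].
- move=> y0 Ky0.
  have nK : \forall y \near y0, K `<=` (fun x => `|F (x, y) - F (x, y0)| <= e).
    move/compact_near_coveringP : (cK); apply => x Kx.
    have : (F p - F (p.1, y0)) @[p --> (x, y0)] --> (0 : R).
      rewrite -(subrr (F (x, y0))); apply: cvgB; first exact: cF.1.
      apply: cvg_comp; last exact: cF.1.
      by apply: cvg_pair; [exact: cvg_fst|exact: cvg_cst].
    move=> /cvgrPdist_le /(_ _ e0).
    by apply: filterS => -[y t]; rewrite sub0r normrN.
  have [h [ch h0 hy0 hU]] := bump (R := R) hausY lcY nK.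
  exists (fun y => 2 * h y); last by rewrite hy0; lra.
  split; [exact: CcZ|by move=> y; rewrite mulr_ge0|move=> w cw w0].
  set k := (fun y => w y * (2 * h y)).
  have ck : Cc k by apply: CcMl => //; exact: CcZ.
  have k0 y : 0 <= k y by rewrite /k !mulr_ge0.
  have cF0k := Cc_tensor (Cc_sectionl y0 cF) ck.
  pose E p := F p * k p.2 + - (F (p.1, y0) * k p.2).
  have cE : Cc E by apply: CcD; [exact: F_snd|exact: CcN].
  have EL (L : (X * Y -> R) -> R) : posfun L -> `|L E| <= e * L (tens u k).
    move=> pL; rewrite -(posfunZ pL); last exact: Cc_tensor.
    apply: (norm_posfun_le pL cE); first exact/CcZ/Cc_tensor.
    move=> [x y]; rewrite /E /tens /= -mulrBl normrM (ger0_norm (k0 y)) mulrA.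
    have [ky0|ky0] := eqVneq (k y) 0; first by rewrite ky0 !mulr0.
    apply: ler_wpM2r => //.
    have Uy : K `<=` (fun x => `|F (x, y) - F (x, y0)| <= e).
      by apply: hU; apply: contraNneq ky0 => hy; rewrite /k hy !mulr0.
    have [Kx|nKx] := pselect (K x).
      by rewrite (le_trans (Uy _ Kx))// ler_peMr ?(ltW e0) ?Ku.
    have F0 z : F (x, z) = 0 by apply: contra_notP nKx => /eqP /FK[].
    by rewrite !F0 subrr normr0 mulr_ge0// ltW.
  have EP (L : (X * Y -> R) -> R) : posfun L ->
      L E = L (fun p => F p * k p.2) - L (fun p => F (p.1, y0) * k p.2).
    by move=> pL; apply: (posfunB pL) => //; exact: F_snd.
  have -> : P (fun p => F p * k p.2) - Q (fun p => F p * k p.2) = P E - Q E.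
    rewrite (EP _ pP) (EP _ pQ) (PQ _ _ (Cc_sectionl y0 cF) ck).
    by rewrite opprB addrA subrK.
  rewrite (le_trans (ler_normB _ _))// mulr_natr mulr2n lerD ?EL//.
  by rewrite [P _](PQ _ _ cu ck) EL.
(* w h is 1 where F lives and is at most v everywhere; the second point keeps
   the bound independent of h, which varies with e *)
pose w y := Num.min (v y) 1 * (Num.max (h y) 1)^-1.
have cw : continuous w.
  move=> y; apply: cvgM.
    by apply: continuous_min; [exact: cv.1|exact: cvg_cst].
  apply: cvgV; first by rewrite gt_eqF// lt_max ltr01 orbT.
  by apply: continuous_max; [exact: ch.1|exact: cvg_cst].
have w0 y : 0 <= w y.
  by rewrite mulr_ge0// ?invr_ge0 ?le_max ?le_min ?v0 ?ler01 ?orbT.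
have FE : (fun p => F p * (w p.2 * h p.2)) = F.
  apply/funext => -[x y] /=; have [->|] := eqVneq (F (x, y)) 0.
    by rewrite mul0r.
  move=> /FK[_ K'y]; rewrite /w (min_idPr (Kv _ K'y)) mul1r.
  rewrite (max_idPl (Kh _ K'y)) mulVf ?mulr1//.
  by rewrite gt_eqF// (lt_le_trans ltr01)// Kh.
have := hw w cw w0; rewrite FE => /le_trans; apply.
rewrite -mulrA ler_wpM2l ?(ltW e0)//.
rewrite (@le_trans _ _ (P (tens u v) * 2))// ?lerDl// ler_wpM2r//.
apply: (le_posfun pP); [exact/Cc_tensor/CcMl|exact: Cc_tensor|].
move=> p; rewrite /tens ler_wpM2l// /w -mulrA.
have m0 : 0 < Num.max (h p.2) 1 by rewrite lt_max ltr01 orbT.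
rewrite -[leRHS]mulr1 ler_pM ?le_min ?v0 ?ler01//.
- by rewrite mulr_ge0// invr_ge0 ltW.
- by rewrite ge_min lexx.
- by rewrite mulrC ler_pdivrMr// mul1r le_max lexx.
Qed.

Lemma posfun_iter (L : (X -> R) -> R) (M : (Y -> R) -> R) :
  posfun L -> posfun M ->
  posfun (fun F : X * Y -> R => L (fun x => M (fun y => F (x, y)))).
Proof.
move=> pL pM; split.
- move=> F G cF cG.
  have cMF := Cc_marginal hausY lcY pM cF.
  have cMG := Cc_marginal hausY lcY pM cG.
  rewrite -(posfunD pL cMF cMG).
  congr L; apply/funext => x; rewrite -(posfunD pM)//; exact: Cc_section.
- move=> a F cF.
  rewrite -(posfunZ pL); last exact: (Cc_marginal hausY lcY pM cF).
  congr L; apply/funext => x; rewrite -(posfunZ pM)//; exact: Cc_section.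
- move=> F cF F0.
  apply: (posfun_ge0 pL); first exact: (Cc_marginal hausY lcY pM cF).
  by move=> x; apply: (posfun_ge0 pM) => //; exact: Cc_section.
Qed.

End tensor.

Section fubini.
Context {R : realType} {X Y : topologicalType}.
Hypotheses (hausX : hausdorff_space X) (lcX : locally_compact [set: X]).
Hypotheses (hausY : hausdorff_space Y) (lcY : locally_compact [set: Y]).

Lemma Cc_swap (F : X * Y -> R) : Cc F -> Cc (fun p => F (p.2, p.1)).
Proof.
move=> cF; have [K [K' [cK cK' FK]]] := supported_prod cF; split.
  move=> [y x]; apply: cvg_comp; last exact: cF.1.
  by apply: cvg_pair; [exact: cvg_snd|exact: cvg_fst].
exists (K' `*` K); first exact: compact_setX.
by move=> [y x] /= /FK[].
Qed.

Lemma posfun_fubini (L : (X -> R) -> R) (M : (Y -> R) -> R) F :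
  posfun L -> posfun M -> Cc F ->
  L (fun x => M (fun y => F (x, y))) = M (fun y => L (fun x => F (x, y))).
Proof.
move=> pL pM.
apply: (posfun_tensor_eq hausX lcX hausY lcY
  (P := fun F => L (fun x => M (fun y => F (x, y))))
  (Q := fun F => M (fun y => L (fun x => F (x, y))))).
- exact: (posfun_iter hausY lcY pL pM).
- have [PD PZ P0] := posfun_iter hausX lcX pM pL; split.
  + by move=> F1 F2 /Cc_swap c1 /Cc_swap c2; exact: (PD _ _ c1 c2).
  + by move=> a F1 /Cc_swap c1; exact: (PZ _ _ c1).
  + by move=> F1 /Cc_swap c1 F0; apply: (P0 _ c1) => p.
- move=> f g cf cg /=.
  have ML x : M (fun y => f x * g y) = M g * f x.
    by rewrite (posfunZ pM _ cg) mulrC.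
  have LM y : L (fun x => f x * g y) = L f * g y.
    rewrite mulrC -(posfunZ pL _ cf); congr L; apply/funext => x; exact: mulrC.
  rewrite (funext ML) (funext LM) (posfunZ pL _ cf) (posfunZ pM _ cg).
  exact: mulrC.
Qed.

End fubini.

(** * Uniqueness of the Haar functional *)

Section group.
Context {G : topologicalGroupType}.

Lemma cvg_mulg T (F : set_system T) {FF : Filter F} (f g : T -> G) (a b : G) :
  f @ F --> a -> g @ F --> b -> (f x * g x)%g @[x --> F] --> (a * b)%g.
Proof.
move=> fa gb.
apply: (@continuous2_cvg _ _ _ _ _ _ _ _ (fun x y : G => (x * y)%g)
  a b _ fa gb).
exact: (@mulg_continuous G (a, b)).
Qed.

Lemma cvg_invg T (F : set_system T) {FF : Filter F} (f : T -> G) (a : G) :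
  f @ F --> a -> (f x)^-1%g @[x --> F] --> (a^-1)%g.
Proof. by move=> fa; apply: cvg_comp fa _; exact: invg_continuous. Qed.

Lemma compact_mulg (A B : set G) : compact A -> compact B ->
  compact [set (x * y)%g | x in A & y in B].
Proof.
move=> cA cB; rewrite image2E; apply: continuous_compact; last exact: compact_setX.
apply: continuous_subspaceT.
rewrite (_ : uncurry _ = fun xy : G * G => (xy.1 * xy.2)%g).
  exact: mulg_continuous.
by apply/funext => -[].
Qed.

Lemma compact_invg (A : set G) : compact A -> compact [set (x^-1)%g | x in A].
Proof.
apply: continuous_compact; apply: continuous_subspaceT.
exact: invg_continuous.
Qed.

End group.

Section haar.
Context {R : realType} {G : topologicalGroupType}.
Hypotheses (hausG : hausdorff_space G) (lcG : locally_compact [set: G]).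
Implicit Types (f g : G -> R) (L M : (G -> R) -> R).

Lemma Cc_translate f a b : Cc f -> Cc (fun x => f (a * x * b)%g).
Proof.
move=> [cf [K cK Kf]]; split.
  move=> x; apply: cvg_comp; last exact: cf.
  by apply: cvg_mulg; [apply: cvg_mulg => //|]; exact: cvg_cst.
exists [set (a^-1 * x * b^-1)%g | x in K]; last first.
  by move=> x /Kf Kx; exists (a * x * b)%g => //; rewrite !mulgA mulVg mul1g mulgK.
apply: continuous_compact => //; apply: continuous_subspaceT => x.
by apply: cvg_mulg; [apply: cvg_mulg => //|]; exact: cvg_cst.
Qed.

Lemma Cc_lmul f a : Cc f -> Cc (fun x => f (a * x)%g).
Proof.
by move=> /(Cc_translate a 1%g); congr Cc; apply/funext => x; rewrite mulg1.
Qed.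

Lemma Cc_rmul f b : Cc f -> Cc (fun x => f (x * b)%g).
Proof.
by move=> /(Cc_translate 1%g b); congr Cc; apply/funext => x; rewrite mul1g.
Qed.

Lemma Cc_inv f : Cc f -> Cc (fun x => f (x^-1)%g).
Proof.
move=> [cf [K cK Kf]]; split.
  by move=> x; apply: cvg_comp; [exact: invg_continuous|exact: cf].
exists [set (x^-1)%g | x in K]; first exact: compact_invg.
by move=> x /Kf Kx; exists (x^-1)%g => //; exact: invgK.
Qed.

Definition left_invariant L :=
  forall a f, Cc f -> L (fun x => f (a * x)%g) = L f.

(** A compact set is covered by finitely many translates of the set where
    h > 0.  If h had integral zero, so would a finite sum of multiples of its
    translates that dominates a given g. *)
Lemma haar_faithful M : posfun M -> left_invariant M ->
  (exists2 g, Cc g & M g != 0) ->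
  forall h, Cc h -> (forall x, 0 <= h x) -> M h = 0 -> forall x, h x = 0.
Proof.
move=> pM lM [g cg Mg] h ch h0 Mh x0; apply: contra_neqP Mg => hx0.
have {}hx0 : 0 < h x0 by rewrite lt_neqAle h0 andbT eq_sym; exact/eqP.
have [K cK Kg] := cg.2.
pose C : set (G -> R) := [set f | [/\ Cc f, (forall x, 0 <= f x) & M f = 0]].
have [||||f [cf f0 Mf] Kf] := @compact_patch R G K C cK.
- by split => //; [exact: Cc0|exact: posfun0].
- move=> f1 f2 [c1 p1 M1] [c2 p2 M2]; split; first exact: CcD.
    by move=> x; exact: addr_ge0.
  by rewrite (posfunD pM)// M1 M2 addr0.
- by move=> f [[]].
- move=> x Kx; exists (fun y => 2 / h x0 * h (x0 * x^-1 * y)%g).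
    split; first exact/CcZ/Cc_lmul.
      by move=> y; rewrite mulr_ge0// divr_ge0// ltW.
    rewrite (posfunZ pM); last exact: Cc_lmul.
    by rewrite lM// Mh mulr0.
  by rewrite mulgVK divfK ?gt_eqF//; lra.
have [B B0 gB] := Cc_bounded cg.
apply/eqP; rewrite -normr_le0 -(mulr0 B) -Mf -(posfunZ pM)//.
apply: (norm_posfun_le pM) => //; first exact: CcZ.
move=> x; have [->|/Kg Kx] := eqVneq (g x) 0.
  by rewrite normr0 mulr_ge0.
by rewrite (le_trans (gB x))// ler_peMr// Kf.
Qed.

Lemma haar_swap_Cc f g : Cc f -> Cc g ->
  Cc (fun p : G * G => f (p.2^-1)%g * g (p.1 * p.2)%g).
Proof.
move=> [cf [K cK Kf]] [cg [K' cK' Kg]]; split.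
  move=> [x y]; apply: cvgM; apply: cvg_comp; try exact: cf; try exact: cg.
    by apply: cvg_invg; exact: cvg_snd.
  by apply: cvg_mulg; [exact: cvg_fst|exact: cvg_snd].
exists ([set (x * y)%g | x in K' & y in K] `*` [set (x^-1)%g | x in K]).
  by apply: compact_setX; [exact: compact_mulg|exact: compact_invg].
move=> [x y] /=; rewrite mulf_eq0 negb_or => /andP[/Kf Ky /Kg Kxy]; split.
  by exists (x * y)%g => //; exists (y^-1)%g => //; rewrite mulgK.
by exists (y^-1)%g => //; rewrite invgK.
Qed.

(** Both sides are the double integral of f(y^-1 x) g(y).  Integrating first in
    x gives the left side by invariance of L; substituting x y for y, which M
    allows, turns the integrand into f(y^-1) g(x y). *)
Lemma haar_swap L M f g : posfun L -> posfun M -> left_invariant L ->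
  left_invariant M -> Cc f -> Cc g ->
  L f * M g = M (fun y => f (y^-1)%g * L (fun x => g (x * y)%g)).
Proof.
move=> pL pM lL lM cf cg.
pose F1 (p : G * G) := f (p.2^-1 * p.1)%g * g p.2.
pose F2 (p : G * G) := f (p.2^-1)%g * g (p.1 * p.2)%g.
have cF2 : Cc F2 by exact: haar_swap_Cc.
have cF1 : Cc F1.
  move: (cf) (cg) => [kf [K cK Kf]] [kg [K' cK' Kg]]; split.
    move=> [x y]; apply: cvgM; apply: cvg_comp; try exact: kf; try exact: kg.
      apply: cvg_mulg; [apply: cvg_invg; exact: cvg_snd|exact: cvg_fst].
    exact: cvg_snd.
  exists ([set (x * y)%g | x in K' & y in K] `*` K').
    by apply: compact_setX => //; exact: compact_mulg.
  move=> [x y] /=; rewrite mulf_eq0 negb_or => /andP[/Kf Ky /Kg Kxy]; split => //.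
  by exists y => //; exists (y^-1 * x)%g => //; rewrite mulVKg.
have -> : L f * M g = M (fun y => L (fun x => F1 (x, y))).
  rewrite -(posfunZ pM)//; congr M; apply/funext => y; rewrite /F1 /= mulrC.
  rewrite -(lL (y^-1)%g)// -(posfunZ pL); last exact: Cc_lmul.
  by congr L; apply/funext => x; rewrite mulrC.
rewrite -(posfun_fubini hausG lcG hausG lcG pL pM cF1).
have -> : (fun x => M (fun y => F1 (x, y))) = (fun x => M (fun y => F2 (x, y))).
  apply/funext => x; rewrite -[LHS](lM x); last exact: Cc_section.
  by congr M; apply/funext => y; rewrite /F1 /F2 /= invgM mulgVK.
rewrite (posfun_fubini hausG lcG hausG lcG pL pM cF2).
congr M; apply/funext => y; rewrite /F2 /= (posfunZ pL)//; exact: Cc_rmul.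
Qed.

(** By [haar_swap], the product of w(y) = L(g1(. y)) M(g2) - L(g2(. y)) M(g1)
    with any compactly supported function has M-integral zero, hence w vanishes
    by faithfulness.  The conclusion is w(1) = 0. *)
Lemma haar_unique L M g1 g2 : posfun L -> posfun M -> left_invariant L ->
  left_invariant M -> Cc g1 -> Cc g2 -> L g1 * M g2 = L g2 * M g1.
Proof.
move=> pL pM lL lM cg1 cg2.
have [M0|] := pselect (exists2 g, Cc g & M g != 0); last first.
  move=> nM; have M0 g : Cc g -> M g = 0.
    by move=> cg; apply: contra_notP nM => /eqP; exists g.
  by rewrite !M0 ?mulr0.
pose w y := L (fun x => g1 (x * y)%g) * M g2 - L (fun x => g2 (x * y)%g) * M g1.
have cD f g : Cc f -> Cc g -> Cc (fun y => f y * L (fun x => g (x * y)%g)).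
  move=> cf cg; have := haar_swap_Cc (Cc_inv cf) cg.
  move=> /Cc_swap/(Cc_marginal hausG lcG pL) /=; congr Cc.
  apply/funext => y; rewrite invgK (posfunZ pL)//; exact: Cc_rmul.
have fw f : Cc f -> Cc (fun y => f y * w y) /\ M (fun y => f y * w y) = 0.
  move=> cf.
  have -> : (fun y => f y * w y) = (fun y =>
      M g2 * (f y * L (fun x => g1 (x * y)%g)) -
      M g1 * (f y * L (fun x => g2 (x * y)%g))).
    by apply/funext => y; rewrite /w; ring.
  have E g : Cc g -> M (fun y => f y * L (fun x => g (x * y)%g)) =
      L (fun x => f (x^-1)%g) * M g.
    move=> cg; rewrite (haar_swap pL pM lL lM (Cc_inv cf) cg).
    by congr M; apply/funext => y; rewrite invgK.
  have c1 := CcZ (M g2) (cD _ _ cf cg1); have c2 := CcZ (M g1) (cD _ _ cf cg2).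
  split; first exact/CcD/CcN.
  by rewrite (posfunB pM c1 c2) !(posfunZ pM) ?E//; [ring|exact: cD..].
have [u [cu _ u1 _]] := bump (R := R) hausG lcG (@filterT _ (nbhs (1%g : G)) _).
have [cuw _] := fw _ cu.
(* the test function u (u w) makes the integrand the square of u w *)
have cuuw : Cc (fun y => u y * (u y * w y)) by apply: CcMl => //; exact: cu.1.
have [cuw2 Muw2] := fw _ cuuw.
have := haar_faithful pM lM M0 cuw2 _ Muw2 1%g.
rewrite u1 !mul1r => w0; apply/eqP; rewrite -subr_eq0 -sqrf_eq0 expr2.
have <- : w 1%g = L g1 * M g2 - L g2 * M g1.
  have E g : (fun x => g (x * 1)%g) = g :> (G -> R).
    by apply/funext => x; rewrite mulg1.
  by rewrite /w !E.
rewrite w0// => x.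
by rewrite (_ : _ * _ = (u x * w x) ^+ 2) ?sqr_ge0//; ring.
Qed.

End haar.

(** * The Chabauty topology *)

Section chabauty.
Context {G : topologicalGroupType}.
Implicit Types (H : SubG G) (U K : set G).

Lemma chabauty_subbase_nbhs H (V : set (SubG G)) :
  chabauty_subbase V -> V H -> nbhs H V.
Proof.
move=> sV VH; apply: open_nbhs_nbhs; split => //.
exists [set V]; last by rewrite bigcup_set1.
by move=> _ ->; exact: (@finI_from1 _ _ _ id).
Qed.

Lemma near_meets H U : open U -> (exists2 x, sub_set H x & U x) ->
  \forall H' \near H, exists2 x, sub_set H' x & U x.
Proof.
move=> oU [x Hx Ux].
have : nbhs H [set H' : SubG G | sub_set H' `&` U !=set0].
  by apply: chabauty_subbase_nbhs; [left; exists U|exists x].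
by apply: filterS => H' [y [? ?]]; exists y.
Qed.

Lemma near_avoids H K : compact K -> (forall x, sub_set H x -> ~ K x) ->
  \forall H' \near H, forall x, sub_set H' x -> ~ K x.
Proof.
move=> cK HK.
have : nbhs H [set H' : SubG G | sub_set H' `&` K = set0].
  apply: chabauty_subbase_nbhs; first by right; exists K.
  by apply/seteqP; split => x //= [] /HK.
by apply: filterS => H' /= H'K x H'x Kx; rewrite -[False]/(set0 x) -H'K.
Qed.

(** It suffices to test convergence on the two kinds of subbasic sets. *)
Lemma chabauty_cvg T (F : set_system T) (f : T -> SubG G) H : Filter F ->
  (forall U, open U -> (exists2 x, sub_set H x & U x) ->
    \forall t \near F, exists2 x, sub_set (f t) x & U x) ->
  (forall K, compact K -> (forall x, sub_set H x -> ~ K x) ->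
    \forall t \near F, forall x, sub_set (f t) x -> ~ K x) ->
  f @ F --> H.
Proof.
move=> FF meets avoids V; rewrite nbhsE => -[W [[D DfinI DW] WH] WV].
move: WH; rewrite -DW => -[B DB BH].
have [D' sD' D'B] := DfinI _ DB.
suff : F (f @^-1` B).
  by apply: filterS => t Bt; apply: WV; rewrite -DW; exists B.
rewrite -D'B preimage_bigcap; apply: filter_bigI => A AD'.
have AH : A H by move: BH; rewrite -D'B; exact.
have := sD' _ AD'; rewrite inE => -[[U oU UA]|[K cK KA]].
  move: AH; rewrite -UA => -[x [Hx Ux]].
  have := meets U oU (ex_intro2 _ _ x Hx Ux).
  by apply: filterS => t [y ? ?]; exists y.
move: AH; rewrite -KA => HK0.
have HK x : sub_set H x -> ~ K x.
  by move=> Hx Kx; rewrite -[False]/(set0 x) -HK0.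
apply: filterS (avoids K cK HK) => t tK.
by apply/seteqP; split => x //= [] /tK.
Qed.

(** If g H g^-1 avoids the compact set K, then so do the conjugates of H by all
    w in a compact neighbourhood W of g, that is, H avoids the compact set of
    the w^-1 k w.  This is a Chabauty-open condition on H. *)
Lemma conj_sub_continuous (R : realType) : hausdorff_space G ->
  locally_compact [set: G] ->
  continuous (fun p : G * SubG G => conj_sub p.1 p.2).
Proof.
move=> hausG lcG [g H]; apply: chabauty_cvg.
- move=> U oU [_ [h Hh <-] Uh].
  have : \forall p \near (g, h), U (p.1 * p.2 * p.1^-1)%g.
    suff c : (p.1 * p.2 * p.1^-1)%g @[p --> (g, h)] --> (g * h * g^-1)%g.
      by apply: c; exact: open_nbhs_nbhs.
    apply: cvg_mulg; first by apply: cvg_mulg; [exact: cvg_fst|exact: cvg_snd].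
    by apply: cvg_invg; exact: cvg_fst.
  move=> [[A B] /= [gA hB] AB].
  have nB : \forall H' \near H, exists2 x, sub_set H' x & B° x.
    apply: near_meets; first exact: open_interior.
    by exists h.
  exists (A, [set H' | exists2 x, sub_set H' x & B° x]) => //=.
  move=> [g' H'] /= [Ag' [x H'x Bx]].
  exists (g' * x * g'^-1)%g; first by exists x.
  by apply: (AB (g', x)); split => //; exact: interior_subset.
- move=> K cK HK.
  have nK : \forall g' \near g, K `<=` (fun x => ~ sub_set H (g'^-1 * x * g')%g).
    move/compact_near_coveringP : (cK); apply => x Kx.
    suff c : (p.2^-1 * p.1 * p.2)%g @[p --> (x, g)] --> (g^-1 * x * g)%g.
      have nH : nbhs (g^-1 * x * g)%g (~` sub_set H).
        apply: open_nbhs_nbhs; split; first exact/closed_openC/sub_closed.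
        move=> Hx; apply: (HK x) => //; exists (g^-1 * x * g)%g => //.
        by rewrite !mulgA mulgV mul1g mulgK.
      exact: (c _ nH).
    apply: cvg_mulg; last exact: cvg_snd.
    by apply: cvg_mulg; [apply: cvg_invg; exact: cvg_snd|exact: cvg_fst].
  have [W cW [gW WK]] := compact_nbhs R hausG lcG nK.
  pose K' := [set (p.1^-1 * p.2 * p.1)%g | p in W `*` K].
  have cK' : compact K'.
    apply: continuous_compact; last exact: compact_setX.
    apply: continuous_subspaceT => -[w x].
    apply: cvg_mulg; last exact: cvg_fst.
    by apply: cvg_mulg; [apply: cvg_invg; exact: cvg_fst|exact: cvg_snd].
  have HK' x : sub_set H x -> ~ K' x.
    by move=> Hx [[w k] [/= Ww Kk] wkx]; apply: (WK w Ww k Kk); rewrite wkx.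
  exists (W, [set H' | forall x, sub_set H' x -> ~ K' x]) => /=.
    by split => //; exact: near_avoids.
  move=> [w H'] /= [Ww H'K] _ [x H'x <-] Kx; apply: (H'K x) => //.
  exists (w, (w * x * w^-1)%g) => //=.
  by rewrite !mulgA mulVg mul1g mulgVK.
Qed.

Lemma conj_subl_continuous (R : realType) H : hausdorff_space G ->
  locally_compact [set: G] -> continuous (fun g => conj_sub g H).
Proof.
move=> hausG lcG g; have cH : H @[_ --> g] --> H by exact: cvg_cst.
exact: cvg_comp (cvg_pair cvg_id cH) (@conj_sub_continuous R hausG lcG (g, H)).
Qed.

End chabauty.

Section discrete.
Context {G : topologicalGroupType}.
Variables (H : SubG G) (dH : discrete_subgroup H).

(** Discreteness isolates the points of H, and closedness takes care of the
    points outside H, so that H accumulates nowhere. *)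
Lemma discrete_near x : \forall y \near x, sub_set H y -> y = x.
Proof.
have [Hx|nHx] := pselect (sub_set H x).
  have [_ [V xV VH]] := dH Hx.
  by apply: filterS xV => y Vy Hy; have : [set x] y by rewrite -VH.
apply: filterS (_ : nbhs x (~` sub_set H)) => [y nHy /nHy//|].
by apply: open_nbhs_nbhs; split => //; exact/closed_openC/sub_closed.
Qed.

(** Local finiteness passes to a compact set through the filter of
    properties that hold for all supersets of some finite set. *)
Lemma discrete_finite K : compact K -> finite_set (sub_set H `&` K).
Proof.
move=> /compact_near_coveringP cK.
pose F : set_system (set G) := [set P | exists2 A, finite_set A &
  forall B, A `<=` B -> P B].
have FF : Filter F.
  split.
  - by exists set0.
  - move=> P Q [A fA PA] [B fB QB]; exists (A `|` B); first by rewrite finite_setU.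
    by move=> C ABC; split; [apply: PA|apply: QB] => x ?; apply: ABC; [left|right].
  - by move=> P Q PQ [A fA PA]; exists A => // B /PA/PQ.
have [x Kx|A fA KA] := cK _ F (fun B x => sub_set H x -> B x) FF.
  exists ([set y | sub_set H y -> y = x], [set B | B x]) => /=.
    by split; [exact: discrete_near|exists [set x] => // B; exact].
  by move=> [y B] [/= Hy Bx] /Hy ->.
by apply: sub_finite_set fA => x [Hx Kx]; exact: KA.
Qed.

End discrete.

(** * Sums over nearby discrete subgroups *)

Section near_products.

Lemma cvg_fst_comp {X Y : topologicalType} {T : Type} (F : set_system T)
    {FF : Filter F} (f : T -> X * Y) (p : X * Y) : f @ F --> p ->
  (fun t => (f t).1) @ F --> (p.1 : X).
Proof. by move=> fp; apply: cvg_comp fp _; case: p => x y; exact: cvg_fst. Qed.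

Lemma cvg_snd_comp {X Y : topologicalType} {T : Type} (F : set_system T)
    {FF : Filter F} (f : T -> X * Y) (p : X * Y) : f @ F --> p ->
  (fun t => (f t).2) @ F --> (p.2 : Y).
Proof. by move=> fp; apply: cvg_comp fp _; case: p => x y; exact: cvg_snd. Qed.

Lemma near_finite_forall {I : choiceType} {T : Type} (F : set_system T)
    (A : set I) (P : I -> T -> Prop) :
  Filter F -> finite_set A ->
  (forall x, A x -> \forall t \near F, P x t) ->
  \forall t \near F, forall x, A x -> P x t.
Proof.
move=> FF fA AP.
have : F (\bigcap_(x in A) P x).
  rewrite -(fset_setK fA); apply: filter_bigI => x.
  by rewrite in_fset_set// inE; exact: AP.
by apply: filterS => t tA x; exact: tA.
Qed.

End near_products.

Section clusters.
Context {R : realType} {G : topologicalGroupType}.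

(** Such a sum is 0 when infinitely many terms are nonzero; for H discrete and
    f compactly supported this does not happen. *)
Definition lattice_sum (H : SubG G) (f : G -> R) : R :=
  \sum_(x \in sub_set H) f x.

Definition fcard {I : choiceType} (A : set I) : R := \sum_(x \in A) (1 : R).

Lemma fcard_ge1 {I : choiceType} (A : set I) x : finite_set A -> A x ->
  1 <= fcard A.
Proof.
move=> fA Ax; rewrite /fcard (fsbigD1 x)//=.
  by rewrite lerDl; exact: fsumr_ge0.
Qed.

Lemma fcardX {I J : choiceType} (A : set I) (B : set J) :
  finite_set A -> finite_set B ->
  fcard A * fcard B = fcard (A `*` B).
Proof.
move=> fA fB; rewrite /fcard -(pair_fsbig _ (fun _ _ => 1))// mulrC mulr_fsumr.
by apply: eq_fsbigr => x _; rewrite mulr1.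
Qed.

Lemma fsum_norm_le {I : choiceType} (A : set I) (f : I -> R) (e : R) :
  finite_set A ->
  (forall x, A x -> `|f x| <= e) ->
  `|\sum_(x \in A) f x| <= e * fcard A.
Proof.
move=> fA fe; rewrite /fcard !fsbig_finite//= big_distrr/=.
apply: (le_trans (ler_norm_sum _ _ _)).
rewrite big_seq [leRHS]big_seq; apply: ler_sum => x.
by rewrite in_fset_set// inE mulr1 => /fe.
Qed.

Lemma nbhs_one_square (P : set ((G * G) * (G * G))) :
  nbhs ((1, 1), (1, 1))%g P ->
  exists O : set G, [/\ open O, O 1%g &
    forall a b c d, O a -> O b -> O c -> O d -> P ((a, b), (c, d))].
Proof.
move=> [[P1 P2] /= [[[A B] /= [A1 B1] AB] [[C D] /= [C1 D1] CD]] P12].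
exists (A `&` B `&` (C `&` D))°; split.
- exact: open_interior.
- by apply: filterI; apply: filterI.
- move=> a b c d /interior_subset [[Aa _] _] /interior_subset [[_ Bb] _].
  move=> /interior_subset [_ [Cc _]] /interior_subset [_ [_ Dd]].
  by apply: P12; split; [apply: AB|apply: CD].
Qed.

(** The combinatorial part of the comparison of the sums over two subgroups.
    Near each point x of L0 that contributes, L has the cluster c(x) F, where F
    is the part of L near 1.  The clusters are disjoint and exhaust the part of
    L that contributes, so the sum over L has a block of #F terms for each term
    of the sum over L0, each of them close to it. *)
Lemma lattice_sum_clusters (L0 L : SubG G) (c : G -> G) (A F O : set G)
    (f f0 : G -> R) (d : R) :
  finite_set A -> finite_set F -> F `<=` O ->
  (forall x, sub_set L0 x -> f0 x != 0 -> A x) -> A `<=` sub_set L0 ->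
  F `<=` sub_set L ->
  (forall x, A x -> sub_set L (c x) /\ O (x^-1 * c x)%g) ->
  (forall x y a b a' b', A x -> A y -> O a -> O b -> O a' -> O b' ->
     (x * a * b = y * a' * b')%g -> x = y) ->
  (forall y, sub_set L y -> f y != 0 ->
     exists x h, [/\ A x, F h & y = c x * h]%g) ->
  (forall x a b, A x -> O a -> O b -> `|f (x * a * b)%g - f0 x| <= d) ->
  `|lattice_sum L f - fcard F * lattice_sum L0 f0| <=
    d * (fcard A * fcard F).
Proof.
move=> fA fF FO f0A AL0 FL cA injA fF' fd.
have [L1 LM LV] := sub_group L.
have cE x : c x = (x * (x^-1 * c x))%g by rewrite mulVKg.
pose m (p : G * G) := (c p.1 * p.2)%g.
have mI : set_inj (A `*` F) m.
  move=> [x h] [y h'] /set_mem[/= Ax Fh] /set_mem[/= Ay Fh'].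
  rewrite /m /= => E.
  have xy : x = y.
    apply: (injA x y (x^-1 * c x)%g h (y^-1 * c y)%g h') => //;
      try exact: FO; try exact: (cA _ _).2.
    by rewrite -!cE.
  by move: E; rewrite xy => /mulgI ->.
have -> : lattice_sum L f = \sum_(p \in A `*` F) f (m p).
  rewrite -(fsbig_image _ _ _ mI); apply/esym/fsbig_widen.
    by move=> _ [[x h] [/= Ax Fh] <-]; apply: LM; [exact: (cA _ Ax).1|exact: FL].
  move=> y [Ly nAF]; apply: contra_notP nAF => /eqP /(fF' _ Ly) [x [h [Ax Fh ->]]].
  by exists (x, h).
have -> : lattice_sum L0 f0 = \sum_(x \in A) f0 x.
  apply/esym/fsbig_widen => // x [L0x nAx].
  by apply: contra_notP nAx => /eqP; exact: f0A.
have fAF : finite_set (A `*` F) by exact: finite_setX.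
have -> : fcard F * \sum_(x \in A) f0 x = \sum_(p \in A `*` F) f0 p.1.
  rewrite -(pair_fsbig _ (fun x _ => f0 x))// mulr_fsumr.
  apply: eq_fsbigr => x _; rewrite mulrC mulr_fsumr.
  by apply: eq_fsbigr => h _; rewrite mulr1.
rewrite fcardX//.
rewrite -[X in _ + X]mulN1r mulr_fsumr -fsbig_split//.
apply: fsum_norm_le => // -[x h] [/= Ax Fh]; rewrite mulN1r /m /= cE.
by apply: fd => //; [exact: (cA _ Ax).2|exact: FO].
Qed.

Hypothesis hausG : hausdorff_space G.

(** The sums over L t converge to the sum over L t0 after division by the
    number of elements of L t in W.  Chabauty convergence provides the clusters
    of [lattice_sum_clusters]: L t meets the neighbourhoods x O of the finitely
    many relevant points x, avoids the rest of the compact set Q, and avoids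
    the compact set of points of W outside O, so that the part of L t in W is
    contained in the small set O.  Without the division the statement fails,
    since L t may contain a nontrivial finite subgroup inside W. *)
Lemma lattice_sum_cvg {T : topologicalType} (t0 : T) (L : T -> SubG G)
    (W Q : set G) (f : T -> G -> R) :
  (forall t, discrete_subgroup (L t)) -> L t @[t --> t0] --> L t0 ->
  compact W -> nbhs 1%g W -> (forall x, sub_set (L t0) x -> W x -> x = 1%g) ->
  compact Q -> (\forall t \near t0, supported Q (f t)) ->
  (forall x, f p.2 p.1 @[p --> (x, t0)] --> f t0 x) ->
  (fcard (sub_set (L t) `&` W))^-1 * lattice_sum (L t) (f t) @[t --> t0] -->
    lattice_sum (L t0) (f t0).
Proof.
move=> dL Lcvg cW nW LW cQ fQ fcvg.
have [L1 LM LV] := sub_group (L t0).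
have W1 : W 1%g by exact: nbhs_singleton.
pose A := sub_set (L t0) `&` Q.
have fA : finite_set A by exact: discrete_finite.
apply/cvgrPdist_le => e e0.
pose d := e / (fcard A + 1).
have cA1 : (0 : R) < fcard A + 1 by rewrite ltr_wpDl//; exact: fsumr_ge0.
have d0 : 0 < d by rewrite divr_gt0.
(* the smallness required of O, as a condition on four points of O: the first
   clause makes the clusters exhaust L t, the second makes them disjoint, and
   the third makes the terms of a cluster close to each other *)
pose P (p : ((G * G) * (G * G)) * T) := [/\ W (p.1.1.1^-1 * p.1.1.2)%g,
  W (p.1.1.1 * p.1.1.2 * p.1.2.1^-1 * p.1.2.2^-1)%g &
  forall x, A x -> `|f t0 x - f p.2 (x * p.1.1.1 * p.1.1.2)%g| <= d].
pose one4 : (G * G) * (G * G) := ((1, 1), (1, 1))%g.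
have c111 : p.1.1.1 @[p --> (one4, t0)] --> (1%g : G).
  exact: cvg_fst_comp (cvg_fst_comp (cvg_fst_comp cvg_id)).
have c112 : p.1.1.2 @[p --> (one4, t0)] --> (1%g : G).
  exact: cvg_snd_comp (cvg_fst_comp (cvg_fst_comp cvg_id)).
have c121 : p.1.2.1 @[p --> (one4, t0)] --> (1%g : G).
  exact: cvg_fst_comp (cvg_snd_comp (cvg_fst_comp cvg_id)).
have c122 : p.1.2.2 @[p --> (one4, t0)] --> (1%g : G).
  exact: cvg_snd_comp (cvg_snd_comp (cvg_fst_comp cvg_id)).
have nP : nbhs (one4, t0) P.
  have nW1 : \forall p \near (one4, t0), W (p.1.1.1^-1 * p.1.1.2)%g.
    have := cvg_mulg (cvg_invg c111) c112.
    by rewrite invg1 mulg1; apply.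
  have nW2 : \forall p \near (one4, t0),
      W (p.1.1.1 * p.1.1.2 * p.1.2.1^-1 * p.1.2.2^-1)%g.
    have := cvg_mulg (cvg_mulg (cvg_mulg c111 c112) (cvg_invg c121)) (cvg_invg c122).
    by rewrite !invg1 !mulg1; apply.
  have nA : \forall p \near (one4, t0), forall x, A x ->
      `|f t0 x - f p.2 (x * p.1.1.1 * p.1.1.2)%g| <= d.
    have H := @near_finite_forall _ _ (nbhs (one4, t0)) A (fun x p =>
      `|f t0 x - f p.2 (x * p.1.1.1 * p.1.1.2)%g| <= d) _ fA.
    apply: H => x _.
      have c : (x * p.1.1.1 * p.1.1.2)%g @[p --> (one4, t0)] --> x.
        have := cvg_mulg (cvg_mulg (cvg_cst x) c111) c112.
        by rewrite !mulg1; apply.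
      have : f p.2 (x * p.1.1.1 * p.1.1.2)%g @[p --> (one4, t0)] --> f t0 x.
        apply: (@cvg_comp _ _ _
          (fun p : ((G * G) * (G * G)) * T => ((x * p.1.1.1 * p.1.1.2)%g, p.2))
          (fun q => f q.2 q.1) _ _ _ _ (fcvg x)).
        by apply: cvg_pair => //; exact: cvg_snd.
      by move=> /cvgrPdist_le/(_ _ d0).
  by near=> p; split; near: p.
move: nP => [[P1 P2] /= [nP1 nP2] P12].
have [ O [oO O1 OP]] := nbhs_one_square nP1.
have PO a b c d1 t : O a -> O b -> O c -> O d1 -> P2 t -> P ((a, b), (c, d1), t).
  by move=> ? ? ? ? ?; apply: P12; split => //; exact: OP.
have oxO x : open [set y | O (x^-1 * y)%g].
  have c : continuous (fun y : G => (x^-1 * y)%g).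
    by move=> y; apply: cvg_mulg => //; exact: cvg_cst.
  by move/continuousP : c => /(_ _ oO).
have near_L (S : SubG G -> Prop) : nbhs (L t0) S -> \forall t \near t0, S (L t).
  by move=> /Lcvg.
have nWO : \forall t \near t0, forall x, sub_set (L t) x -> ~ (W `\` O) x.
  apply: (near_L (fun H => forall x, sub_set H x -> ~ (W `\` O) x)).
  apply: near_avoids.
    apply: (subclosed_compact _ cW) => [|x []//]; rewrite setDE.
    by apply: closedI; [exact: compact_closed|exact: open_closedC].
  by move=> x Lx [Wx]; rewrite (LW x Lx Wx).
pose xO := \bigcup_(x in A) [set y | O (x^-1 * y)%g].
have nQO : \forall t \near t0, forall x, sub_set (L t) x -> ~ (Q `\` xO) x.
  apply: (near_L (fun H => forall x, sub_set H x -> ~ (Q `\` xO) x)).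
  apply: near_avoids.
    apply: (subclosed_compact _ cQ) => [|x []//]; rewrite setDE.
    apply: closedI; first exact: compact_closed.
    apply: open_closedC.
    by apply: bigcup_open => x _.
  by move=> x Lx [Qx]; apply; exists x => //=; rewrite mulVg.
have nA : \forall t \near t0, forall x, A x ->
    exists2 y, sub_set (L t) y & O (x^-1 * y)%g.
  have H := @near_finite_forall _ _ (nbhs t0) A (fun x t =>
    exists2 y, sub_set (L t) y & O (x^-1 * y)%g) _ fA.
  apply: H => x [Lx _].
  apply: (near_L (fun H => exists2 y, sub_set H y & O (x^-1 * y)%g)).
  apply: near_meets; first exact: oxO.
  exists x => //=.
  by rewrite mulVg.
near=> t.
have tWO : forall x, sub_set (L t) x -> ~ (W `\` O) x by near: t.
have tQO : forall x, sub_set (L t) x -> ~ (Q `\` xO) x by near: t.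
have tA : forall x, A x -> exists2 y, sub_set (L t) y & O (x^-1 * y)%g by near: t.
have P2t : P2 t by near: t.
have tQ : supported Q (f t) by near: t.
have Q0 : supported Q (f t0) by exact: nbhs_singleton fQ.
have [Lt1 LtM LtV] := sub_group (L t).
pose F := sub_set (L t) `&` W.
have fF : finite_set F by exact: discrete_finite.
have F1 : (1 : R) <= fcard F by apply: (fcard_ge1 fF (x := 1%g)).
have FO : F `<=` O.
  by move=> x [Lx Wx]; apply: contrapT => nOx; exact: (tWO x Lx).
have [c cA] : {c : G -> G &
    forall x, A x -> sub_set (L t) (c x) /\ O (x^-1 * c x)%g}.
  apply: (choice (P := fun x y => A x -> sub_set (L t) y /\ O (x^-1 * y)%g)).
  move=> x; have [/tA[y Ly Oy]|nAx] := pselect (A x); first by exists y.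
  by exists 1%g.
have F0 : (0 : R) < fcard F by exact: lt_le_trans F1.
have := @lattice_sum_clusters (L t0) (L t) c A F O (f t) (f t0) d
  fA fF FO _ _ _ cA _ _ _.
have E : lattice_sum (L t0) (f t0) - (fcard F)^-1 * lattice_sum (L t) (f t) =
  - ((fcard F)^-1 *
     (lattice_sum (L t) (f t) - fcard F * lattice_sum (L t0) (f t0))).
  by rewrite mulrBr mulKf ?gt_eqF// opprB.
rewrite E normrN normrM gtr0_norm ?invr_gt0// ler_pdivrMl// => H.
apply: (le_trans (H _ _ _ _ _ _)).
- by move=> x Lx /Q0.
- by move=> x [].
- by move=> x [].
- move=> x y a b a' b' [Lx _] [Ly _] Oa Ob Oa' Ob' E'.
  have [_ Wy _] := PO _ _ _ _ _ Oa' Ob' Ob Oa P2t.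
  have xy : (a' * b' * b^-1 * a^-1 = y^-1 * x)%g.
    apply: (mulgI y); rewrite mulVKg !mulgA -E'.
    by rewrite -!mulgA (mulgA b) mulgV mul1g mulgV mulg1.
  have /LW := LM _ _ (LV _ Ly) Lx; rewrite -xy => /(_ Wy).
  by rewrite xy => yx; rewrite -[y]mulg1 -yx mulVKg.
- move=> y Ly /tQ Qy.
  have [x Ax Oxy] : xO y.
    by apply: contrapT => nxOy; exact: (tQO y Ly).
  have [Lc Oc] := cA x Ax.
  exists x, ((c x)^-1 * y)%g; split => //; last by rewrite mulVKg.
  split; first by apply: LtM => //; exact: LtV.
  have [Wcy _ _] := PO _ _ _ _ _ Oc Oxy O1 O1 P2t.
  by move: Wcy; rewrite /= invgM invgK -mulgA mulVKg.
- move=> x a b Ax Oa Ob; have [_ _ +] := PO _ _ _ _ _ Oa Ob O1 O1 P2t.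
  by move=> /(_ x Ax) /=; rewrite distrC.
rewrite mulrA [leRHS]mulrC ler_wpM2r ?(ltW F0)//.
by rewrite /d mulrAC ler_pdivrMr// ler_wpM2l// ?(ltW e0)// lerDl.
Unshelve. all: by end_near. Qed.

End clusters.

(** * Integration of continuous functions on compact spaces *)

Section borel.
Context {R : realType}.

Lemma continuous_borel_measurable {X Y : ptopologicalType} (f : X -> Y) :
  continuous f -> measurable_fun setT (f : borel X -> borel Y).
Proof.
move=> /continuousP cf.
apply: (@measurability _ _ (borel X) (borel Y) setT f (@open Y)) => //.
move=> _ [U oU <-]; rewrite setTI; apply: sub_sigma_algebra; exact: cf.
Qed.

Lemma continuous_borelR_measurable {X : ptopologicalType} (f : X -> R) :
  continuous f -> measurable_fun setT (f : borel X -> R).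
Proof.
move=> /continuousP cf; apply: (measurability (@measurable_realfun.RGenOInfty.G R)).
  exact: measurable_realfun.RGenOInfty.measurableE.
move=> _ [_ [x ->] <-]; rewrite setTI; apply: sub_sigma_algebra.
by apply: cf; exact: interval_open.
Qed.

Lemma continuous_borel_integrable {X : ptopologicalType}
    (m : probability (borel X) R) (f : X -> R) :
  compact [set: X] -> continuous f ->
  m.-integrable setT (EFin \o (f : borel X -> R)).
Proof.
move=> cX cf; apply: measurable_bounded_integrable => //.
- by rewrite [ltLHS](probability_setT m) ltry.
- exact: continuous_borelR_measurable.
have [|B B0 fB] := @Cc_bounded R X f.
  by split => //; exists setT.
exists B; split; first exact: num_real.
by move=> M BM x _; apply: (le_trans (fB x)); exact: ltW.
Qed.

Lemma Rintegral_image d1 d2 (X : measurableType d1) (Y : measurableType d2)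
    (m : measure X R) (m' : measure Y R) (phi : X -> Y) (f : Y -> R) :
  measurable_fun setT phi -> measurable_fun setT f ->
  m.-integrable setT (EFin \o f \o phi) ->
  (forall A, measurable A -> m' A = m (phi @^-1` A)) ->
  \int[m']_y f y = \int[m]_x f (phi x).
Proof.
move=> mphi mf intf m'E; rewrite /Rintegral; congr fine.
have := @integral_pushforward _ _ _ _ R phi mphi m setT (EFin \o f) _ intf
  measurableT.
rewrite preimage_setT => <-; last exact/measurable_realfun.measurable_EFinP.
apply: eq_measure_integral => A mA _; exact: m'E.
Qed.

End borel.

(** * The Haar functional of a uniform lattice *)

Section lattice_sums.
Context {R : realType} {G : topologicalGroupType}.
Hypotheses (hausG : hausdorff_space G) (lcG : locally_compact [set: G]).
Variables (H : SubG G) (dH : discrete_subgroup H).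
Implicit Types f g : G -> R.

Lemma lattice_sum_supported Q f : supported Q f ->
  lattice_sum H f = \sum_(x \in sub_set H `&` Q) f x.
Proof.
move=> fQ; apply/esym/fsbig_widen => [x []//|x [Hx nHQ]].
by apply: contra_notP nHQ => /eqP/fQ.
Qed.

Lemma lattice_sumD f g : Cc f -> Cc g ->
  lattice_sum H (fun x => f x + g x) = lattice_sum H f + lattice_sum H g.
Proof.
move=> [_ [K cK fK]] [_ [K' cK' gK']].
rewrite (@lattice_sum_supported (K `|` K')) => [|x]; last first.
  have [->|/fK] := eqVneq (f x) 0; last by left.
  by rewrite add0r => /gK'; right.
rewrite (@lattice_sum_supported (K `|` K') f) => [|x /fK]; last by left.
rewrite (@lattice_sum_supported (K `|` K') g) => [|x /gK']; last by right.
by rewrite fsbig_split//; apply: discrete_finite => //; exact: compactU.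
Qed.

Lemma lattice_sumZ a f : lattice_sum H (fun x => a * f x) = a * lattice_sum H f.
Proof. by rewrite /lattice_sum mulr_fsumr. Qed.

Lemma lattice_sum_ge0 f : (forall x, 0 <= f x) -> 0 <= lattice_sum H f.
Proof. by move=> f0; exact: fsumr_ge0. Qed.

Lemma lattice_sum_ge f x : Cc f -> (forall x, 0 <= f x) -> sub_set H x ->
  f x <= lattice_sum H f.
Proof.
move=> [_ [K cK fK]] f0 Hx; have [->|fx] := eqVneq (f x) 0.
  exact: lattice_sum_ge0.
rewrite (lattice_sum_supported fK) (fsbigD1 x)//=.
- by rewrite lerDl; exact: fsumr_ge0.
- by apply: (sub_finite_set _ (discrete_finite dH cK)) => y [].
- by split => //; exact: fK.
Qed.

Lemma lattice_sum_lmul f h : sub_set H h ->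
  lattice_sum H (fun x => f (h * x)%g) = lattice_sum H f.
Proof.
have [_ HM HV] := sub_group H => Hh.
rewrite /lattice_sum [RHS](@reindex_fsbig _ _ _ _ _ (fun x => h * x)%g (sub_set H))//.
split.
- by move=> x Hx; exact: HM.
- by move=> x y _ _ /mulgI.
- by move=> x Hx; exists (h^-1 * x)%g; [apply: HM => //; exact: HV|rewrite mulVKg].
Qed.

End lattice_sums.

Definition coset_sum {R : realType} {G : topologicalGroupType} (H : SubG G)
  (f : G -> R) g := lattice_sum H (fun x => f (g * x)%g).

Section coset_sums.
Context {R : realType} {G : topologicalGroupType}.
Hypotheses (hausG : hausdorff_space G) (lcG : locally_compact [set: G]).
Implicit Types (f : G -> R) (g h : G).

Lemma coset_sum_cvg {T : topologicalType} (t0 : T) (L : T -> SubG G)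
    (W : set G) f g0 :
  (forall t, discrete_subgroup (L t)) -> L t @[t --> t0] --> L t0 ->
  compact W -> nbhs 1%g W -> (forall x, sub_set (L t0) x -> W x -> x = 1%g) ->
  Cc f ->
  (fcard (sub_set (L p.2) `&` W))^-1 * coset_sum (L p.2) f p.1
    @[p --> (g0, t0)] --> coset_sum (L t0) f g0.
Proof.
move=> dL Lcvg cW nW LW [cf [K cK Kf]].
have [B cB [gB _]] := compact_nbhs R hausG lcG (@filterT _ (nbhs g0) _).
pose Q := [set (x * y)%g | x in [set (x^-1)%g | x in B] & y in K].
have cQ : compact Q by apply: compact_mulg => //; exact: compact_invg.
apply: (@lattice_sum_cvg R G hausG (G * T)%type (g0, t0) (fun p => L p.2) W Q
  (fun p x => f (p.1 * x)%g)) => //.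
- by apply: cvg_comp Lcvg; exact: cvg_snd.
- exists (B, setT); first by split => //; exact: filterT.
  move=> [g t] [/= Bg _] x /Kf Kgx; exists (g^-1)%g; first by exists g.
  by exists (g * x)%g => //; rewrite mulKg.
- move=> x; apply: cvg_comp; last exact: cf.
  apply: cvg_mulg; last exact: cvg_fst.
  by apply: (cvg_fst_comp (p := (g0, t0))); exact: cvg_snd.
Qed.

Variables (H : SubG G) (dH : discrete_subgroup H).

Lemma discrete_compact_nbhs : exists W : set G, [/\ compact W, nbhs 1%g W &
  forall x, sub_set H x -> W x -> x = 1%g].
Proof.
have [W cW [nW WV]] := compact_nbhs R hausG lcG (discrete_near dH 1%g).
by exists W; split => // x Hx /WV; exact.
Qed.

(** The constant family in [coset_sum_cvg], with W so small that the
    normalizing count is 1. *)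
Lemma coset_sum_continuous f : Cc f -> continuous (coset_sum H f).
Proof.
move=> cf g0; have [W [cW nW HW]] := discrete_compact_nbhs.
have HW1 : sub_set H `&` W = [set 1%g].
  apply/seteqP; split => [x [Hx Wx]|_ ->]; first exact: HW.
  by split; [have [] := sub_group H|exact: nbhs_singleton].
have cH : H @[_ --> g0] --> H by exact: cvg_cst.
have c1 := @coset_sum_cvg G g0 (fun=> H) W f g0 (fun=> dH) cH cW nW HW cf.
have E : coset_sum H f = (fun p : G * G =>
    (fcard (sub_set H `&` W))^-1 * coset_sum H f p.1) \o (fun g => (g, g0)).
  by apply/funext => g /=; rewrite HW1 /fcard fsbig_set1 invr1 mul1r.
suff : coset_sum H f @ g0 --> coset_sum H f g0 by [].
rewrite [X in X @ _]E; apply: (@cvg_comp _ _ _ (fun g : G => (g, g0))); last exact: c1.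
by apply: cvg_pair => //; exact: cvg_cst.
Qed.

Lemma coset_sum_invr f g h : sub_set H h ->
  coset_sum H f (g * h)%g = coset_sum H f g.
Proof.
move=> Hh; rewrite /coset_sum -[RHS](lattice_sum_lmul _ Hh).
by congr lattice_sum; apply/funext => x; rewrite mulgA.
Qed.

Lemma coset_sum_translate f a g :
  coset_sum H (fun x => f (a * x)%g) g = coset_sum H f (a * g)%g.
Proof. by congr lattice_sum; apply/funext => x; rewrite mulgA. Qed.

Lemma coset_sumM f w g :
  (forall g h, sub_set H h -> w (g * h)%g = w g) ->
  coset_sum H (fun x => w x * f x) g = w g * coset_sum H f g.
Proof.
move=> wH; rewrite /coset_sum -lattice_sumZ /lattice_sum.
by apply: eq_fsbigr => x /set_mem Hx; rewrite wH.
Qed.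

End coset_sums.

Section coset_space.
Context {R : realType} {G : topologicalGroupType}.
Hypotheses (hausG : hausdorff_space G) (lcG : locally_compact [set: G]).
Variables (H : SubG G) (uH : uniform_lattice H).
Local Notation X := (coset_space H).

Lemma coset_space_compact : compact [set: X].
Proof.
have [_ [K cK HK]] := uH.
have -> : [set: X] = (\pi_(coset_space H) : G -> X) @` [set (x^-1)%g | x in K].
  apply/seteqP; split => // q _.
  have : [set: G] (repr q)^-1%g by [].
  rewrite -HK => -[x Hx [k Kk xk]].
  exists (k^-1)%g; first by exists k.
  rewrite -[RHS]reprK; apply/eqmodP/asboolP; rewrite invgK.
  have -> : repr q = (k^-1 * x^-1)%g by rewrite -invgM xk invgK.
  by rewrite mulVKg; have [_ _] := sub_group H; apply.
apply: continuous_compact; last exact: compact_invg.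
by apply: continuous_subspaceT; exact: pi_continuous.
Qed.

(** A right H-invariant function on G descends to the quotient; the class q is
    evaluated at its chosen representative. *)
Lemma coset_fun_continuous (Z : topologicalType) (w : G -> Z) : continuous w ->
  (forall g h, sub_set H h -> w (g * h)%g = w g) ->
  continuous (w \o repr : X -> Z).
Proof.
move=> /continuousP cw wH; apply/continuousP => A oA.
rewrite /open /= /quotient_open.
rewrite (_ : _ @^-1` _ = w @^-1` A); first exact: cw.
apply/seteqP; split => x /=; have [h Hh ->] := repr_coset H x; by rewrite wH.
Qed.

Lemma pi_coset_mulr (g h : G) : sub_set H h ->
  \pi_(coset_space H) (g * h)%g = \pi_(coset_space H) g.
Proof.
move=> Hh; apply/eqmodP/asboolP.
have -> : ((g * h)^-1 * g = h^-1)%g by rewrite invgM mulgVK.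
by have [_ _] := sub_group H; apply.
Qed.

Lemma conj_sub_mulr (g h : G) : sub_set H h ->
  conj_sub (g * h)%g H = conj_sub g H.
Proof. by move=> Hh; rewrite -!coset_conjE pi_coset_mulr. Qed.

Lemma coset_act_continuous (a : G) : continuous (coset_act a : X -> X).
Proof.
apply: (@coset_fun_continuous _ (fun g => \pi_(coset_space H) (a * g)%g)).
  move=> g; apply: continuous_comp; last exact: pi_continuous.
  by apply: cvg_mulg => //; exact: cvg_cst.
by move=> g h Hh; rewrite mulgA; exact: pi_coset_mulr.
Qed.

Lemma coset_conj_continuous : continuous (@coset_conj G H : X -> SubG G).
Proof.
apply: (@coset_fun_continuous _ (fun g => conj_sub g H)).
  exact: (conj_subl_continuous R hausG lcG).
exact: conj_sub_mulr.
Qed.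

End coset_space.

Section lattice_haar.
Context {R : realType} {G : topologicalGroupType}.
Hypotheses (hausG : hausdorff_space G) (lcG : locally_compact [set: G]).
Variables (H : SubG G) (uH : uniform_lattice H).
Variable m : probability (borel (coset_space H)) R.
Hypothesis m_inv : forall (g : G) (A : set (borel (coset_space H))),
  measurable A ->
  pushforward m (coset_act g : borel _ -> borel (coset_space H)) A = m A.
Implicit Types f w : G -> R.

Definition lattice_haar f : R := \int[m]_q coset_sum H f (repr q).

Let cX := coset_space_compact uH.

Let integrable w : continuous w ->
  (forall g h, sub_set H h -> w (g * h)%g = w g) ->
  m.-integrable setT (EFin \o (w \o repr : borel (coset_space H) -> R)).
Proof.
move=> cw wH; apply: continuous_borel_integrable => //.
exact: coset_fun_continuous.
Qed.

Let integrable_sum f : Cc f ->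
  m.-integrable setT (EFin \o (coset_sum H f \o repr : borel (coset_space H) -> R)).
Proof.
move=> cf; apply: integrable; first exact: (coset_sum_continuous hausG lcG uH.1).
by move=> g h Hh; rewrite coset_sum_invr.
Qed.

Lemma lattice_haar_posfun : posfun lattice_haar.
Proof.
split.
- move=> f g cf cg; rewrite /lattice_haar -RintegralD//;
    [|exact: integrable_sum..].
  apply: eq_Rintegral => q _; rewrite /coset_sum -(lattice_sumD uH.1)//;
    exact: Cc_lmul.
- move=> a f cf; rewrite /lattice_haar -RintegralZl//; last exact: integrable_sum.
  by apply: eq_Rintegral => q _; rewrite /coset_sum -lattice_sumZ.
- by move=> f cf f0; apply: Rintegral_ge0 => q _; exact: lattice_sum_ge0.
Qed.

Lemma lattice_haar_invariant : left_invariant lattice_haar.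
Proof.
move=> a f cf; rewrite /lattice_haar.
have cfa := coset_sum_continuous hausG lcG uH.1 cf.
have fH g h : sub_set H h -> coset_sum H f (g * h)%g = coset_sum H f g.
  by move=> Hh; rewrite coset_sum_invr.
have cr := coset_fun_continuous cfa fH.
rewrite [RHS](@Rintegral_image R _ _ _ _ m m
    (coset_act a : borel (coset_space H) -> borel (coset_space H))).
- apply: eq_Rintegral => q _; rewrite coset_sum_translate /coset_act.
  by have [h Hh E] := repr_coset H (a * repr q)%g; rewrite -(fH _ _ Hh) -E.
- apply: continuous_borel_measurable => q; exact: coset_act_continuous.
- exact: continuous_borelR_measurable.
- apply: (@continuous_borel_integrable _ _ m
    ((coset_sum H f \o repr) \o coset_act a)) => //.
  by move=> q; apply: continuous_comp; [exact: coset_act_continuous|exact: cr].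
- by move=> A mA; exact: esym (m_inv a mA).
Qed.

(** The weight f / N_H f has sum 1 over every coset, so that multiplying an
    H-invariant w by it and unfolding gives back the integral of w over the
    quotient.  The constant c is the cluster size when this is applied. *)
Lemma lattice_haar_normalized f w c : Cc f -> (forall g, 0 < coset_sum H f g) ->
  continuous w -> (forall g h, sub_set H h -> w (g * h)%g = w g) ->
  lattice_haar (fun x => w x * (c * (coset_sum H f x)^-1 * f x)) =
  c * \int[m]_q w (repr q).
Proof.
move=> cf f0 cw wH; rewrite -RintegralZl//; last exact: integrable.
apply: eq_Rintegral => q _.
have -> : (fun x => w x * (c * (coset_sum H f x)^-1 * f x)) =
  (fun x => (w x * (c * (coset_sum H f x)^-1)) * f x).
  by apply/funext => x; rewrite !mulrA.
rewrite coset_sumM; first by rewrite mulrA mulfVK ?gt_eqF// mulrC.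
by move=> g h Hh; rewrite wH// coset_sum_invr.
Qed.

End lattice_haar.

(** * Continuity of the lattice measures *)

Section lattice_irs.
Context {R : realType} {G : topologicalGroupType}.
Hypotheses (hausG : hausdorff_space G) (lcG : locally_compact [set: G]).

Lemma ulat_val_continuous : continuous (val : ULat G -> SubG G).
Proof. exact: initial_continuous. Qed.

Lemma ulat_uniform (Gam : ULat G) : uniform_lattice (val Gam).
Proof. by have /set_mem := valP Gam. Qed.

(** If the sum at g is positive, then some point g x with x in H lies in the
    support K of f, and the sum at s g equals the sum at s (g x), a point of
    s K.  So positivity on the sets s K propagates along words in S. *)
Lemma coset_sum_gt0_generated (H : SubG G) (S K : set G) (f : G -> R) :
  smallest (@is_subgroup G) S = setT -> supported K f ->
  0 < coset_sum H f 1%g ->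
  (forall s k, S s -> K k -> 0 < coset_sum H f (s * k)%g) ->
  (forall s k, S s -> K k -> 0 < coset_sum H f (s^-1 * k)%g) ->
  forall g, 0 < coset_sum H f g.
Proof.
move=> SG Kf f1 fS fSV.
have step t g : (forall k, K k -> 0 < coset_sum H f (t * k)%g) ->
    0 < coset_sum H f g -> 0 < coset_sum H f (t * g)%g.
  move=> ft fg; have [x [Hx fgx]] : exists x, sub_set H x /\ f (g * x)%g != 0.
    apply: contrapT => nx; move: fg; rewrite /coset_sum /lattice_sum fsbig1 ?ltxx//.
    by move=> x Hx; apply: contrapT => /eqP fx; apply: nx; exists x.
  by rewrite -(coset_sum_invr _ _ Hx) -mulgA; apply: ft; exact: Kf.
pose U : set G := [set s | forall g, 0 < coset_sum H f g ->
  0 < coset_sum H f (s * g)%g /\ 0 < coset_sum H f (s^-1 * g)%g].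
have gU : is_subgroup U.
  split.
  - by move=> g fg; rewrite invg1 mul1g.
  - move=> x y Ux Uy g fg; rewrite invgM -!mulgA; split.
      by apply: (Ux _ _).1; apply: (Uy _ fg).1.
    by apply: (Uy _ _).2; apply: (Ux _ fg).2.
  - by move=> x Ux g fg; rewrite invgK; have [? ?] := Ux g fg.
have SU : S `<=` U.
  by move=> s Ss g fg; split; apply: step => // k Kk; [exact: fS|exact: fSV].
move=> g; have /(_ 1%g f1) [] : U g.
  by apply: (smallest_sub gU SU); rewrite SG.
by rewrite mulg1.
Qed.

(** If G = H K, then every coset g H meets K^-1, where f is at least 1. *)
Lemma lattice_partition_fun (H : SubG G) : uniform_lattice H ->
  exists f : G -> R,
    [/\ Cc f, (forall x, 0 <= f x) & forall g, 0 < coset_sum H f g].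
Proof.
move=> [dH [K cK HK]].
have [f [cf f0 fK]] := cutoff (R := R) hausG lcG (compact_invg cK).
exists f; split => // g.
have : [set: G] (g^-1)%g by []; rewrite -HK => -[x Hx [k Kk xk]].
apply: (@lt_le_trans _ _ (f (g * x)%g)).
  apply: (lt_le_trans ltr01); apply: fK; exists k => //.
  by rewrite -[g]invgK -xk invgM mulgVK.
apply: (lattice_sum_ge (f := fun x => f (g * x)%g) dH) => //; exact: Cc_lmul.
Qed.

Variables (I : ULat G -> IRS R G).
Hypothesis I_mu : forall Gam : ULat G, is_lattice_irs Gam (I Gam).
Hypothesis cgG : compactly_generated G.

(** By [coset_sum_gt0_generated], positivity everywhere is positivity on one
    compact set that does not depend on the lattice, where it is an open
    condition by [coset_sum_cvg]. *)
Lemma near_coset_sum_gt0 (Gam0 : ULat G) (f : G -> R) : Cc f ->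
  (forall g, 0 < coset_sum (val Gam0) f g) ->
  \forall Gam \near Gam0, forall g, 0 < coset_sum (val Gam) f g.
Proof.
move=> cf f0; have [S cS SG] := cgG; have [K cK Kf] := cf.2.
have dL (Gam : ULat G) : discrete_subgroup (val Gam) := (ulat_uniform Gam).1.
have [W [cW nW HW]] := discrete_compact_nbhs (R := R) hausG lcG (dL Gam0).
have k0 (Gam : ULat G) : (0 : R) < fcard (sub_set (val Gam) `&` W).
  apply: (@lt_le_trans _ _ (1 : R)) => //.
  apply: (fcard_ge1 (x := 1%g)); first exact: discrete_finite.
  by split; [have [] := sub_group (val Gam)|exact: nbhs_singleton].
have nD D : compact D -> \forall Gam \near Gam0,
    D `<=` (fun g => 0 < coset_sum (val Gam) f g).
  move/compact_near_coveringP => cD.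
  apply: (cD _ (nbhs Gam0) (fun (Gam : ULat G) g => 0 < coset_sum (val Gam) f g)
    (nbhs_filter Gam0)) => g _.
  have := @coset_sum_cvg R G hausG lcG (ULat G) Gam0 val W f g dL
    (@ulat_val_continuous Gam0) cW nW HW cf.
  move=> /(cvgr_gt _) /(_ _ (f0 g)); apply: filterS => -[g1 Gam] /=.
  by rewrite pmulr_rgt0 ?invr_gt0 ?k0.
have n1 := nD _ (@compact_set1 G 1%g).
have nS := nD _ (compact_mulg cS cK).
have nSV := nD _ (compact_mulg (compact_invg cS) cK).
near=> Gam.
apply: (coset_sum_gt0_generated SG Kf).
- have : [set 1%g] `<=` (fun g => 0 < coset_sum (val Gam) f g) by near: Gam.
  exact.
- move=> s k Ss Kk.
  have : [set (x * y)%g | x in S & y in K] `<=`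
    (fun g => 0 < coset_sum (val Gam) f g) by near: Gam.
  by apply; exists s => //; exists k.
- move=> s k Ss Kk.
  have : [set (x * y)%g | x in [set (x^-1)%g | x in S] & y in K] `<=`
    (fun g => 0 < coset_sum (val Gam) f g) by near: Gam.
  by apply; exists (s^-1)%g; [exists s|exists k].
Unshelve. all: by end_near. Qed.

(** All that the final argument uses of the invariant measure: it gives a Haar
    functional on G from which the integrals of continuous functions against
    the measure on the space of subgroups can be recovered. *)
Lemma lattice_irs_integral (Gam : ULat G) : exists2 L : (G -> R) -> R,
  posfun L /\ left_invariant L &
  forall f c, Cc f -> (forall g, 0 < coset_sum (val Gam) f g) ->
    L (fun x => c * (coset_sum (val Gam) f x)^-1 * f x) = c /\
    forall w : SubG G -> R, continuous w ->
      L (fun x => w (conj_sub x (val Gam)) *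
                  (c * (coset_sum (val Gam) f x)^-1 * f x))
      = c * \int[irs_prob (I Gam)]_H w H.
Proof.
have [m m_inv mI] := I_mu Gam; have uH := ulat_uniform Gam.
exists (lattice_haar m).
  split; first exact: lattice_haar_posfun.
  exact: lattice_haar_invariant.
move=> f c cf f0; split.
  have := @lattice_haar_normalized R G (val Gam) uH m f (fun=> 1) c cf f0.
  move=> /(_ (fun=> cvg_cst _) (fun _ _ _ => erefl)).
  rewrite Rintegral_cst// (_ : fine _ = 1) ?mulr1; last first.
    by transitivity (fine 1%E : R) => //; congr fine; exact: probability_setT.
  by under [X in lattice_haar m X]eq_fun do rewrite mul1r.
move=> w cw.
have cwc : continuous (fun g => w (conj_sub g (val Gam))).
  move=> g; apply: continuous_comp; last exact: cw.
  exact: (conj_subl_continuous R hausG lcG).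
rewrite (lattice_haar_normalized uH m c cf f0 cwc); last first.
  by move=> g h Hh; rewrite conj_sub_mulr.
congr (_ * _); apply/esym.
have cc := @coset_conj_continuous R G hausG lcG (val Gam).
apply: (@Rintegral_image R _ _ _ _ m (irs_prob (I Gam))
  (@coset_conj G (val Gam) : borel _ -> borel (SubG G)) w).
- exact: continuous_borel_measurable.
- exact: continuous_borelR_measurable.
- apply: (@continuous_borel_integrable _ _ m (w \o @coset_conj G (val Gam))).
    exact: coset_space_compact.
  by move=> q; apply: continuous_comp; [exact: cc|exact: cw].
- exact: mI.
Qed.

(** With psi = k f / N f and wpsi its product with w along conjugates, the
    functional of the nearby lattice takes the values k and k times the sought
    integral on psi and wpsi.  Uniqueness then expresses that integral as the
    quotient of the values of the fixed functional L0, and these converge. *)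
Lemma lattice_irs_integral_cvg (Gam0 : ULat G) (w : SubG G -> R) :
  continuous w ->
  \int[irs_prob (I Gam)]_H w H @[Gam --> Gam0] -->
    \int[irs_prob (I Gam0)]_H w H.
Proof.
move=> cw; have [f [cf f_ge0 f0]] := lattice_partition_fun (ulat_uniform Gam0).
have dL (Gam : ULat G) : discrete_subgroup (val Gam) := (ulat_uniform Gam).1.
have [W [cW nW HW]] := discrete_compact_nbhs (R := R) hausG lcG (dL Gam0).
have [K cK Kf] := cf.2.
pose k (Gam : ULat G) : R := fcard (sub_set (val Gam) `&` W).
have k0 Gam : 0 < k Gam.
  apply: (@lt_le_trans _ _ (1 : R)) => //.
  apply: (fcard_ge1 (x := 1%g)); first exact: discrete_finite.
  by split; [have [] := sub_group (val Gam)|exact: nbhs_singleton].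
have k1 : k Gam0 = 1.
  rewrite /k (_ : _ `&` _ = [set 1%g]) ?/fcard ?fsbig_set1//.
  apply/seteqP; split => [x [Hx Wx]|_ ->]; first exact: HW.
  by split; [have [] := sub_group (val Gam0)|exact: nbhs_singleton].
have nf := near_coset_sum_gt0 cf f0.
have [L0 [pL0 lL0] L0E] := lattice_irs_integral Gam0.
pose psi (Gam : ULat G) x := k Gam * (coset_sum (val Gam) f x)^-1 * f x.
pose wpsi (Gam : ULat G) x := w (conj_sub x (val Gam)) * psi Gam x.
have psiC Gam : (forall g, 0 < coset_sum (val Gam) f g) ->
    Cc (psi Gam) /\ supported K (psi Gam).
  move=> fG; split.
    apply: CcMl => // x; apply: cvgM; first exact: cvg_cst.
    apply: cvgV; first by rewrite gt_eqF.
    exact: (coset_sum_continuous hausG lcG (dL Gam) cf).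
  by move=> x; rewrite mulf_eq0 negb_or => /andP[_ /Kf].
have wpsiC Gam : (forall g, 0 < coset_sum (val Gam) f g) ->
    Cc (wpsi Gam) /\ supported K (wpsi Gam).
  move=> /psiC[cp Kp]; split; last first.
    by move=> x; rewrite mulf_eq0 negb_or => /andP[_ /Kp].
  apply: CcMl => // g; apply: continuous_comp; last exact: cw.
  exact: (conj_subl_continuous R hausG lcG).
have psi_cvg x : psi p.2 p.1 @[p --> (x, Gam0)] --> psi Gam0 x.
  apply: cvgM; last by apply: cvg_comp; [exact: cvg_fst|exact: cf.1].
  rewrite k1 mul1r.
  have -> : (fun p : G * ULat G => k p.2 * (coset_sum (val p.2) f p.1)^-1) =
      (fun p => ((k p.2)^-1 * coset_sum (val p.2) f p.1)^-1).
    by apply/funext => p; rewrite invfM invrK.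
  apply: cvgV; first exact: lt0r_neq0.
  exact: (@coset_sum_cvg R G hausG lcG (ULat G) Gam0 val W f x dL
    (@ulat_val_continuous Gam0) cW nW HW cf).
have wpsi_cvg x : wpsi p.2 p.1 @[p --> (x, Gam0)] --> wpsi Gam0 x.
  apply: cvgM; last exact: psi_cvg.
  have c : val p.2 @[p --> (x, Gam0)] --> val Gam0.
    apply: (@cvg_comp _ _ _ snd val _ (nbhs Gam0)); first exact: cvg_snd.
    exact: (@ulat_val_continuous Gam0).
  have c2 : (p.1, val p.2) @[p --> (x, Gam0)] --> (x, val Gam0).
    exact: cvg_pair cvg_fst c.
  have c3 := @cvg_comp _ _ _ (fun p : G * ULat G => (p.1, val p.2))
    (fun q => conj_sub q.1 q.2) _ _ _ c2
    (@conj_sub_continuous G R hausG lcG (x, val Gam0)).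
  exact: (@cvg_comp _ _ _ _ w _ _ _ c3 (cw _)).
have ucvg : L0 (psi Gam) @[Gam --> Gam0] --> L0 (psi Gam0).
  apply: (posfun_cvg hausG lcG pL0 cK psi_cvg).
  by apply: filterS nf => Gam; exact: psiC.
have vcvg : L0 (wpsi Gam) @[Gam --> Gam0] --> L0 (wpsi Gam0).
  apply: (posfun_cvg hausG lcG pL0 cK wpsi_cvg).
  by apply: filterS nf => Gam; exact: wpsiC.
have [psi1 wpsi1] := L0E f (k Gam0) cf f0.
rewrite psi1 k1 in ucvg; rewrite (wpsi1 w cw) k1 mul1r in vcvg.
have F0 : Filter (nbhs Gam0) := nbhs_filter Gam0.
have uinv : (L0 (psi Gam))^-1 @[Gam --> Gam0] --> (1 : R)^-1.
  exact: (@cvgV _ _ _ F0 _ _ (oner_neq0 R) ucvg).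
have uv : L0 (wpsi Gam) * (L0 (psi Gam))^-1 @[Gam --> Gam0] -->
    \int[irs_prob (I Gam0)]_H w H * (1 : R)^-1.
  exact: (@cvgM _ _ _ F0 _ _ _ _ vcvg uinv).
rewrite invr1 mulr1 in uv.
suff uvE : \forall Gam \near Gam0,
    L0 (wpsi Gam) * (L0 (psi Gam))^-1 = \int[irs_prob (I Gam)]_H w H.
  exact: cvg_trans (near_eq_cvg uvE) uv.
have nu : \forall Gam \near Gam0, 0 < L0 (psi Gam).
  exact: (@cvgr_gt _ _ _ F0 _ _ ucvg 0 ltr01).
near=> Gam.
have fG : forall g, 0 < coset_sum (val Gam) f g by near: Gam.
have u0 : 0 < L0 (psi Gam) by near: Gam.
have [L [pL lL] LE] := lattice_irs_integral Gam.
have [LEpsi LEw] := LE f (k Gam) cf fG.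
have := haar_unique hausG lcG pL pL0 lL lL0 (wpsiC _ fG).1 (psiC _ fG).1.
rewrite [L (psi _)]LEpsi [L (wpsi _)](LEw w cw) -mulrA.
move=> /(mulfI (lt0r_neq0 (k0 Gam))) /= <-.
by rewrite mulfK// lt0r_neq0.
Unshelve. all: by end_near. Qed.

End lattice_irs.

Theorem proposition11p2 (R : realType) (G : topologicalGroupType)
    (hausG : hausdorff_space G) (lcG : locally_compact [set: G])
    (cgG : compactly_generated G)
    (I : ULat G -> IRS R G)
    (I_mu : forall Gam : ULat G, is_lattice_irs Gam (I Gam)) :
  continuous I.
Proof.
apply: continuous_comp_initial => Gam0.
have FI := fmap_filter (@irs_integral R G \o I) (nbhs_filter Gam0).
apply/cvg_sup => w.
have cI : continuous ((fun f => f w) \o (@irs_integral R G \o I)).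
  move=> Gam.
  apply: (@lattice_irs_integral_cvg R G hausG lcG I I_mu cgG Gam w).
  exact: cts_fun.
exact: (@continuous_comp_initial _ _ _ (fun f => f w)
  (@irs_integral R G \o I) cI Gam0).
Qed.
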